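(* Let $K$ be a field and let $G$ be a cochordal graph with no isolated vertices. Then the following conditions are equivalent: (i) the complementary graph $G^c$ is connected and has a cut vertex; (ii) $g_{I(G)}(1)=1$; (iii) $g_{I(G)}(1)=1$ and $g_{I(G)}(k)=0$ for all $k$ with $2\le k\le \nu(G)$.
   Context: $G$ is a finite simple graph (no loops, multiple edges or directed edges) on the vertex set $[n]=\{1,\dots,n\}$ with at least one edge. The complementary graph $G^c$ has vertex set $[n]$, and $\{i,j\}$ with $i\ne j$ is an edge of $G^c$ if and only if it is not an edge of $G$. $G$ is cochordal if $G^c$ is chordal, i.e. $G^c$ has no induced cycles of length greater than $3$. A cut vertex of a connected graph $H$ is a vertex $i$ such that the graph $H-\{i\}$ obtained by deleting $i$ is disconnected. The edge ideal $I(G)\subset S=K[x_1,\dots,x_n]$ is generated by all $x_ix_j$ with $\{i,j\}\in E(G)$. The matching number $\nu(G)$ is the maximum size of a set of pairwise disjoint edges of $G$. For a squarefree monomial ideal $I\subset S$ (nonzero, proper), the $k$th squarefree power $I^{[k]}$ is the monomial ideal of $S$ generated by the squarefree monomials belonging to $I^k$. The monomial grade $\nu(I)$ is the biggest length of a monomial regular sequence contained in $I$; equivalently $I^{[k]}\neq(0)$ if and only if $k\le\nu(I)$. One has $\nu(I(G))=\nu(G)$. For $1\le k\le \nu(I)$, $d_k=\mathrm{indeg}(I^{[k]})$ is the minimum degree of a monomial generator of $I^{[k]}$, and the normalized depth function of $I$ is $g_I(k)=\mathrm{depth}(S/I^{[k]})-(d_k-1)$ for $1\le k\le\nu(I)$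 (this is always a non-negative integer). Thus for $I=I(G)$ one has $d_k=2k$. *)

(* Defs.v *)
From HB Require Import structures.
From mathcomp Require Import all_boot all_order all_algebra.
From mathcomp.multinomials Require Import mpoly.
From Stdlib Require Import ClassicalEpsilon.
Set Implicit Arguments.
Unset Strict Implicit.
Unset Printing Implicit Defensive.
Import GRing.Theory.
Local Open Scope ring_scope.

(* Maximum and minimum of a set of natural numbers; unspecified when the set  *)
(* has no maximum, resp. is empty.                                            *)
Definition is_max (P : nat -> Prop) (m : nat) : Prop :=
  P m /\ forall j, P j -> (j <= m)%N.

Definition is_min (P : nat -> Prop) (m : nat) : Prop :=
  P m /\ forall j, P j -> (m <= j)%N.

Definition max_nat (P : nat -> Prop) : nat := epsilon (inhabits 0%N) (is_max P).
Definition min_nat (P : nat -> Prop) : nat := epsilon (inhabits 0%N) (is_min P).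

(* A graph on a finite type T is given by its adjacency relation, assumed     *)
(* symmetric and irreflexive where it is used.                                *)
Section Graphs.
Variable T : finType.
Implicit Types (e : rel T) (A : {set T}).

Definition compl_graph e : rel T := [rel x y | (x != y) && ~~ e x y].

Definition induced_graph e A : rel T :=
  [rel x y | [&& x \in A, y \in A & e x y]].

Definition connected_on e A : Prop :=
  {in A &, forall x y, connect (induced_graph e A) x y}.

Definition connected_graph e : Prop := connected_on e [set: T].

(* To be used for a connected graph e. *)
Definition cut_vertex e (x : T) : Prop := ~ connected_on e [set~ x].

(* [next c x] is the cyclic successor of x in c, so that c is a cycle of e    *)
(* without chords.                                                            *)
Definition induced_cycle e (c : seq T) : Prop :=
  uniq c /\ {in c &, forall x y, e x y = (next c x == y) || (next c y == x)}.

Definition chordal e : Prop :=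
  forall c : seq T, induced_cycle e c -> (size c <= 3)%N.

Definition cochordal e : Prop := chordal (compl_graph e).

Definition no_isolated e : Prop := forall x, exists y, e x y.

Definition edges e : {set {set T}} :=
  [set [set u.1; u.2] | u in [pred u : T * T | e u.1 u.2]].

Definition matching e (M : {set {set T}}) : bool :=
  (M \subset edges e) && trivIset M.

Definition matching_number e : nat :=
  (\max_(M : {set {set T}} | matching e M) #|M|)%N.

End Graphs.

(* Ideals of K[x_1, ..., x_n] are represented by their membership predicates. *)
Section Ideals.
Variables (K : fieldType) (n : nat).
Local Notation S := {mpoly K[n]}.
Implicit Types (I J : S -> Prop) (f : seq S).

Definition ideal_gen (A : S -> Prop) : S -> Prop := fun p =>
  exists s : seq (S * S),
    (forall u, u \in s -> A u.2) /\ p = \sum_(u <- s) u.1 * u.2.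

Definition ideal_pow I (k : nat) : S -> Prop :=
  ideal_gen (fun p => exists s : k.-tuple S,
    (forall q, q \in s -> I q) /\ p = \prod_(q <- s) q).

Definition squarefree_mnm (m : 'X_{1..n}) : Prop := forall i, (m i <= 1)%N.

Definition squarefree_pow I (k : nat) : S -> Prop :=
  ideal_gen (fun p => exists m : 'X_{1..n},
    [/\ p = 'X_[m], squarefree_mnm m & ideal_pow I k p]).

(* x^m is a minimal monomial generator of the monomial ideal J; (m' <= m)%MM  *)
(* means that x^m' divides x^m.                                               *)
Definition monomial_generator J (m : 'X_{1..n}) : Prop :=
  J 'X_[m] /\ forall m' : 'X_{1..n}, J 'X_[m'] -> (m' <= m)%MM -> m' = m.

Definition indeg J : nat :=
  min_nat (fun d => exists m, monomial_generator J m /\ mdeg m = d).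

Definition max_ideal : S -> Prop := ideal_gen (fun p => exists i : 'I_n, p = 'X_i).

Definition add_ideal J f : S -> Prop := ideal_gen (fun p => J p \/ p \in f).

(* f is an (S/J)-regular sequence of elements of S. *)
Definition regular_seq J f : Prop :=
  ~ add_ideal J f 1 /\
  forall i, (i < size f)%N -> forall p,
    add_ideal J (take i f) (f`_i * p) -> add_ideal J (take i f) p.

(* depth of S/J: the maximal length of an (S/J)-regular sequence contained    *)
(* in the graded maximal ideal.                                               *)
Definition depth_quotient J : nat :=
  max_nat (fun r => exists f,
    [/\ size f = r, forall q, q \in f -> max_ideal q & regular_seq J f]).

Definition norm_depth I (k : nat) : int :=
  (depth_quotient (squarefree_pow I k))%:Z
    - ((indeg (squarefree_pow I k))%:Z - 1).

End Ideals.

Definition edge_ideal (K : fieldType) (n : nat) (e : rel 'I_n) :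
    {mpoly K[n]} -> Prop :=
  ideal_gen (fun p => exists i j, e i j /\ p = 'X_i * 'X_j).

Arguments edge_ideal K {n} e _.

(* Main.v *)
Require Import Defs.
From mathcomp Require Import all_boot all_order all_algebra.
From mathcomp.multinomials Require Import mpoly.
From mathcomp Require Import ring zify.
From Stdlib Require Import Classical ClassicalEpsilon.
From Stdlib Require Import FunctionalExtensionality PropExtensionality.
Set Implicit Arguments.
Unset Strict Implicit.
Unset Printing Implicit Defensive.
Import GRing.Theory.
Local Open Scope ring_scope.

(** Let [H] be the complement of [G].  The squarefree power [I(G)^[k]] is the
    Stanley-Reisner ideal of the complex of vertex sets that contain no
    [k]-matching of [G] ([squarefree_pow_edge_ideal]); for [k = 1] this is the
    clique complex of [H].  Everything reduces to computing depths of such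
    rings: condition (ii) says that the depth for [k = 1] is 2, and (iii) adds
    that the depth for [k >= 2] is [2k - 1].

    Lower bounds.  The elementary symmetric polynomials in all the variables are
    a regular sequence on every Stanley-Reisner ring up to a length that can be
    read off a decomposition of the complex.  On a simplex they are regular up
    to its number of vertices ([weakly_regular_simplex]), and the exact sequence
    relating [S/I] to [S/(I:f)] and [S/(I+f)] propagates regularity
    ([weakly_regular_colon_adjoin]); for a vertex variable [f] these are the
    cone over the link and the deletion of the vertex.  Two decompositions
    occur.  A complex that contains all sets of at most [r] vertices has depth
    at least [r] ([weakly_regular_skeleton]), which gives [2k - 1] for the
    [k]-th power.  The clique complex of a chordal graph is dismantled by
    removing simplicial vertices ([simplicial_exists]); if the graph is
    [c]-connected each of them has at least [c] neighbours, so the depth is at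
    least [c + 1] ([weakly_regular_clique_complex]).

    Upper bounds.  A regular sequence of length [r] in the maximal ideal kills
    the Koszul cohomology of [x_1, .., x_n] in degrees below [r]
    ([koszul_vanishing]).  A disconnected link, possibly after deleting some
    vertices [U], produces an explicit nonzero class
    ([size_regular_separated]).  The link of the empty face bounds the depth for
    [k = 1] by 1 when [H] is disconnected, and by 2 when [U] consists of a cut
    vertex.  So the depth for [k = 1] equals 2 exactly when [H] is connected and
    has a cut vertex, since a connected chordal [H] without cut vertex is
    2-connected and gives depth at least 3.

    Finally, let [v] be a cut vertex of [H] and [A], [B] a separation of the
    rest; then [G] contains all the edges between [A] and [B], and an edge at
    [v].  If [k >= 2] and [G] has a [k]-matching, they allow to find a set [F] of [2k - 2] vertices with
    a disconnected link in the complex of [I(G)^[k]]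
    ([separating_face_exists]), and the depth is at most [2k - 1]. *)

(** * Weakly regular sequences modulo an ideal *)

Section WeaklyRegular.
Variable R : comNzRingType.
Implicit Types (I J : R -> Prop) (f t p q x : R) (s : seq R).

Definition is_ideal I : Prop :=
  [/\ I 0, forall p q, I p -> I q -> I (p + q) & forall a p, I p -> I (a * p)].

Definition colon I f : R -> Prop := fun p => I (f * p).
Definition adjoin I f : R -> Prop := fun p => exists q, I (p - f * q).
Definition adjoins I s : R -> Prop := foldl adjoin I s.

Definition nonzerodivisor_mod I f : Prop := forall p, I (f * p) -> I p.

(** Recursion on the head of the sequence, so that the induction steps below
    only ever compare one ideal [I] with [adjoin I t]. *)
Fixpoint weakly_regular I s : Prop :=
  if s is t :: s' then
    nonzerodivisor_mod I t /\ weakly_regular (adjoin I t) s'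
  else True.

Section IdealTheory.
Variable I : R -> Prop.
Hypothesis idI : is_ideal I.

Lemma ideal0 : I 0. Proof. by case: idI. Qed.
Lemma idealD p q : I p -> I q -> I (p + q).
Proof. by case: idI => _ h _; exact: h. Qed.
Lemma ideal_mull a p : I p -> I (a * p). Proof. by case: idI => _ _; exact. Qed.
Lemma ideal_mulr a p : I p -> I (p * a).
Proof. by rewrite mulrC; exact: ideal_mull. Qed.
Lemma idealN p : I p -> I (- p).
Proof. by move=> Ip; rewrite -mulN1r; exact: ideal_mull. Qed.
Lemma idealB p q : I p -> I q -> I (p - q).
Proof. by move=> Ip Iq; apply: idealD => //; exact: idealN. Qed.

Lemma ideal_sum (T : Type) (r : seq T) (P : pred T) (F : T -> R) :
  (forall i, P i -> I (F i)) -> I (\sum_(i <- r | P i) F i).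
Proof. by move=> IF; apply: big_ind => //; [exact: ideal0 | exact: idealD]. Qed.

Lemma ideal_congr p q : I (p - q) -> (I p <-> I q).
Proof.
move=> Ipq; split=> [Ip|Iq].
- by rewrite -[q](subKr p); exact: idealB.
- by rewrite -(subrK q p); exact: idealD.
Qed.

Lemma adjoin_ideal f : is_ideal (adjoin I f).
Proof.
split.
- by exists 0; rewrite mulr0 subrr; exact: ideal0.
- move=> p q [a Ha] [b Hb]; exists (a + b).
  suff -> : p + q - f * (a + b) = (p - f * a) + (q - f * b) by exact: idealD.
  by ring.
- move=> a p [b Hb]; exists (a * b).
  suff -> : a * p - f * (a * b) = a * (p - f * b) by exact: ideal_mull.
  by ring.
Qed.

Lemma sub_adjoin f p : I p -> adjoin I f p.
Proof. by exists 0; rewrite mulr0 subr0. Qed.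

Lemma mem_adjoin f q : adjoin I f (f * q).
Proof. by exists q; rewrite subrr; exact: ideal0. Qed.

End IdealTheory.

Lemma adjoins_ideal I s : is_ideal I -> is_ideal (adjoins I s).
Proof.
by rewrite /adjoins; elim: s I => [|t s IHs] I idI //=; exact/IHs/adjoin_ideal.
Qed.

Lemma sub_adjoins I s p : is_ideal I -> I p -> adjoins I s p.
Proof.
rewrite /adjoins; elim: s I => [|t s IHs] I idI Ip //=.
by apply: IHs; [exact: adjoin_ideal | exact: sub_adjoin].
Qed.

Lemma adjoin_ext I J f :
  (forall p, I p <-> J p) -> forall p, adjoin I f p <-> adjoin J f p.
Proof. by move=> IJ p; split=> -[q Hq]; exists q; apply/IJ. Qed.

Lemma adjoin_swap I f g :
  forall p, adjoin (adjoin I f) g p <-> adjoin (adjoin I g) f p.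
Proof.
by move=> p; split=> -[a [b H]]; exists b, a; rewrite addrAC.
Qed.

Lemma weakly_regular_ext I J s : (forall p, I p <-> J p) ->
  weakly_regular I s -> weakly_regular J s.
Proof.
elim: s I J => [|t s IHs] I J IJ //= [Ht Hs]; split.
- by move=> p /IJ/Ht/IJ.
- by apply: IHs Hs => p; exact: adjoin_ext.
Qed.

Lemma weakly_regular_rcons I s t :
  weakly_regular I (rcons s t) <->
  weakly_regular I s /\ nonzerodivisor_mod (adjoins I s) t.
Proof.
rewrite /adjoins; elim: s I => [|u s IHs] I /=; first by tauto.
by rewrite IHs; tauto.
Qed.

Lemma weakly_regular_unit_ideal I s :
  is_ideal I -> (forall p, I p) -> weakly_regular I s.
Proof.
elim: s I => [|t s IHs] I idI H //=; split=> [p _ //|].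
by apply: IHs; [exact: adjoin_ideal | move=> p; exact: sub_adjoin].
Qed.

(** Exactness of [0 -> R/(I:f) -> R/I -> R/(I+f) -> 0] propagates regularity
    from both ends to the middle.  Since [t] is a nonzerodivisor modulo
    [I + f], passing to [I + t] commutes with forming the colon, which is what
    the induction needs. *)
Lemma weakly_regular_colon_adjoin I f s : is_ideal I ->
  weakly_regular (colon I f) s -> weakly_regular (adjoin I f) s ->
  weakly_regular I s.
Proof.
elim: s I => [|t s IHs] I idI //= [nzc regc] [nza rega].
have idIf := adjoin_ideal idI f; have idIt := adjoin_ideal idI t.
have nzt : nonzerodivisor_mod I t.
  move=> p Itp; have [|q Iq] := nza p; first exact: sub_adjoin.
  have /nzc : colon I f (t * q).
    rewrite /colon; suff -> : f * (t * q) = t * p - t * (p - f * q).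
      by apply: idealB => //; exact: ideal_mull.
    by ring.
  by rewrite /colon => Ifq; apply/(ideal_congr idI Iq).
split=> //; apply: IHs => //.
- apply: weakly_regular_ext regc => p; split.
  + by move=> [q]; rewrite /colon => H; exists (f * q); move: H; congr I; ring.
  + move=> [q Hq]; have [|r Hr] := nza q.
      exists p; have := idealN idI Hq; congr I; ring.
    exists r; apply: nzt.
    have := idealD idI (ideal_mull idI t Hq) (ideal_mull idI (t * t) Hr).
    by congr I; ring.
- by apply: weakly_regular_ext rega => p; exact: adjoin_swap.
Qed.

End WeaklyRegular.

(** * Stanley-Reisner ideals *)

Section StanleyReisner.
Variables (K : fieldType) (n : nat).
Local Notation S := {mpoly K[n]}.
Implicit Types (m : 'X_{1..n}) (A B F : {set 'I_n}) (D : {set {set 'I_n}}).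
Implicit Types (p q : S).

Definition mnm_supp m : {set 'I_n} := [set i | (0 < m i)%N].

Lemma mnm_suppD m1 m2 : mnm_supp (m1 + m2) = mnm_supp m1 :|: mnm_supp m2.
Proof. by apply/setP=> i; rewrite !inE mnmDE addn_gt0. Qed.

Lemma mnm_supp_mesym1 F : mnm_supp (mesym1 F) = F.
Proof. by apply/setP=> i; rewrite !inE mnmE lt0b. Qed.

Lemma mesym1_le F m : (mesym1 F <= m)%MM = (F \subset mnm_supp m).
Proof.
apply/mnm_lepP/subsetP => [le i iF|sFm i].
- by have := le i; rewrite mnmE iF inE.
- by rewrite mnmE; case: (boolP (i \in F)) => // /sFm; rewrite inE.
Qed.

Lemma mcoeffM_eq0 p q m :
  (forall k1 k2, m = (k1 + k2)%MM -> p@_k1 * q@_k2 = 0) -> (p * q)@_m = 0.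
Proof. by move=> H; rewrite mcoeffM big1 // => -[k1 k2] /= /eqP; exact: H. Qed.

Definition down_closed D : Prop :=
  forall A B, A \subset B -> B \in D -> A \in D.

(** The Stanley-Reisner ideal of the complex [D], described through its
    standard monomials: those supported on a face have coefficient zero. *)
Definition SR D : S -> Prop := fun p => forall m, mnm_supp m \in D -> p@_m = 0.

Lemma SR_ideal D : down_closed D -> is_ideal (SR D).
Proof.
move=> dD; split=> [m _|p q Ip Iq m Dm|a p Ip m Dm]; first by rewrite mcoeff0.
- by rewrite mcoeffD Ip ?Iq ?addr0.
- apply: mcoeffM_eq0 => k1 k2 mE; rewrite (Ip k2) ?mulr0 //; apply: dD Dm.
  by rewrite mE mnm_suppD subsetUr.
Qed.

Lemma SR_monomial D F : SR D 'X_[mesym1 F] <-> F \notin D.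
Proof.
split=> [H|ND m mD].
- apply/negP => FD; have := H (mesym1 F); rewrite mnm_supp_mesym1 => /(_ FD).
  by rewrite mcoeffX eqxx => /eqP; rewrite oner_eq0.
- rewrite mcoeffX; case: (_ =P m) => // E; case/negP: ND.
  by rewrite -(mnm_supp_mesym1 F) E.
Qed.

Lemma colon_SR D F p :
  colon (SR D) 'X_[mesym1 F] p <-> SR [set A | A :|: F \in D] p.
Proof.
rewrite /colon; split=> H m; rewrite ?inE => mD.
- rewrite -(mcoeffMX p (mesym1 F)) mulrC; apply: H.
  by rewrite mnm_suppD mnm_supp_mesym1 setUC.
- have [le|nle] := boolP (mesym1 F <= m)%MM.
    move: mD; rewrite -(submK le) addmC mnm_suppD mnm_supp_mesym1 mulrC => mD.
    by rewrite mcoeffMX; apply: H; rewrite inE setUC.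
  apply: mcoeffM_eq0 => k1 k2 mE; rewrite mcoeffX.
  by case: eqP => [E|]; [rewrite mE E lem_addr in nle | rewrite mul0r].
Qed.

Lemma adjoin_SR D F p :
  adjoin (SR D) 'X_[mesym1 F] p <-> SR [set A in D | ~~ (F \subset A)] p.
Proof.
set x := 'X_[_]; split=> [[q H] m|H].
- rewrite inE => /andP[mD NF]; have := H m mD.
  rewrite mcoeffB => /eqP; rewrite subr_eq0 => /eqP ->.
  apply: mcoeffM_eq0 => k1 k2 mE; rewrite mcoeffX.
  case: eqP => [E|]; last by rewrite mul0r.
  by rewrite -mesym1_le mE E lem_addr in NF.
- exists (\sum_(m <- msupp p | (mesym1 F <= m)%MM)
             p@_m *: 'X_[(m - mesym1 F)%MM]).
  rewrite mulr_sumr.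
  under eq_bigr => m le do rewrite -scalerAr -mpolyXD addmC submK //.
  move=> m mD; rewrite mcoeffB {1}[p]mpolyE.
  rewrite (bigID (fun m => (mesym1 F <= m)%MM)) /= mcoeffD addrAC subrr add0r.
  rewrite raddf_sum /= big1 // => k nle; rewrite mcoeffZ mcoeffX.
  case: eqP => [E|_]; last by rewrite mulr0.
  by rewrite (H k) ?mul0r // inE E mD -mesym1_le -E.
Qed.

End StanleyReisner.

(** * Permuting homogeneous regular sequences *)

Section Permutation.
Variables (K : fieldType) (n : nat).
Local Notation S := {mpoly K[n]}.
Implicit Types (I : S -> Prop) (p q t x : S) (s : seq S).

Definition homogeneous_ideal I : Prop :=
  forall d p, I p -> I (pihomog mdeg d p).

Lemma pihomogMl k d t p : t \is k.-homog ->
  pihomog mdeg d (t * p) = if (k <= d)%N then t * pihomog mdeg (d - k) p else 0.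
Proof.
move=> ht; rewrite {1}(pihomog_partitionE (leqnn (mmeasure mdeg p))).
rewrite mulr_sumr raddf_sum /=.
have E (i : nat) : pihomog mdeg d (t * pihomog mdeg i p) =
    if (k + i == d)%N then t * pihomog mdeg i p else 0.
  have h := dhomogM ht (pihomogP mdeg i p).
  by case: eqP => [<-|/eqP ne]; [exact: pihomog_dE | exact: pihomog_ne0 ne h].
under eq_bigr => i _ do rewrite E.
case: leqP => [le_kd|lt_dk]; last first.
  by rewrite big1 // => i _; case: eqP => // Ed; lia.
have [lt|ge] := ltnP (d - k) (mmeasure mdeg p).
- rewrite (bigD1 (Ordinal lt)) //= subnKC // eqxx big1 ?addr0 // => i ne.
  case: eqP => // Ed; case/eqP: ne; apply/val_inj => /=; lia.
- have -> : pihomog mdeg (d - k) p = 0.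
    rewrite pihomogE big_seq_cond big1 // => m.
    by case/andP=> /(mmeasure_mnm_lt mdeg) mp /eqP Em; lia.
  by rewrite mulr0 big1 // => i _; case: eqP => // Ed; have := ltn_ord i; lia.
Qed.

Lemma homogeneous_adjoin I k t : homogeneous_ideal I -> t \is k.-homog ->
  is_ideal I -> homogeneous_ideal (adjoin I t).
Proof.
move=> hI ht idI d p [q /(hI d)]; rewrite raddfB /= (pihomogMl _ _ ht).
case: ifP => _ H; first by exists (pihomog mdeg (d - k) q).
by exists 0; rewrite mulr0.
Qed.

Lemma homogeneous_components I p : is_ideal I ->
  (forall d, I (pihomog mdeg d p)) -> I p.
Proof.
move=> idI H; rewrite (pihomog_partitionE (leqnn (mmeasure mdeg p))).
exact: ideal_sum.
Qed.

(** Nakayama's lemma in graded form: a syzygy [t p] in [I] forces [p] into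
    [I + x], say [p = x q] modulo [I], where [q] satisfies the same syzygy and
    has smaller degree. *)
Lemma nonzerodivisor_descent I k t x : is_ideal I -> homogeneous_ideal I ->
  x \is 1.-homog -> t \is k.-homog ->
  nonzerodivisor_mod I x -> nonzerodivisor_mod (adjoin I x) t ->
  nonzerodivisor_mod I t.
Proof.
move=> idI hI hx ht nzx nzt p Itp; apply: homogeneous_components => // d.
have {Itp} : I (t * pihomog mdeg d p).
  by have := hI (k + d)%N _ Itp; rewrite (pihomogMl _ _ ht) leq_addr addKn.
have : pihomog mdeg d p \is d.-homog by exact: pihomogP.
elim: d {p} (pihomog _ _ _) => [|d IHd] p hp Itp.
- have [|q /(hI 0%N)] := nzt p; first exact: sub_adjoin.
  by rewrite raddfB /= (pihomogMl _ _ hx) /= subr0 pihomog_dE.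
- have [|q /(hI d.+1)] := nzt p; first exact: sub_adjoin.
  rewrite raddfB /= (pihomogMl _ _ hx) /= subn1 /= pihomog_dE //.
  move: (pihomogP mdeg d q); set r := pihomog _ _ _ => hr Ir.
  have Itr : I (t * r).
    apply: nzx; have := idealB idI Itp (ideal_mull idI t Ir).
    by congr I; ring.
  by apply/(ideal_congr idI Ir); apply: (ideal_mull idI); exact: (IHd r hr Itr).
Qed.

(** Descent moves each [t] in front of [x]; that [x] remains a nonzerodivisor
    modulo [I + t] is then formal and needs no grading. *)
Lemma weakly_regular_permute I s x : is_ideal I -> homogeneous_ideal I ->
  x \is 1.-homog -> (forall t, t \in s -> exists k, t \is k.-homog) ->
  nonzerodivisor_mod I x -> weakly_regular (adjoin I x) s ->
  weakly_regular I s /\ nonzerodivisor_mod (adjoins I s) x.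
Proof.
elim: s I => [|t s IHs] I idI hI hx hs nzx //= [nzt regs].
have [k ht] := hs t (mem_head _ _).
have nztI := nonzerodivisor_descent idI hI hx ht nzx nzt.
have nzxt : nonzerodivisor_mod (adjoin I t) x.
  move=> p [q Hq]; have [|r Hr] := nzt q.
    by exists p; have := idealN idI Hq; congr I; ring.
  exists r; apply: nzx; have := idealD idI Hq (ideal_mull idI t Hr).
  by congr I; ring.
have hs' u : u \in s -> exists k, u \is k.-homog.
  by move=> us; apply: hs; rewrite inE us orbT.
have [|regIs nzs] := IHs _ (adjoin_ideal idI t) (homogeneous_adjoin hI ht idI)
  hx hs' nzxt; last by [].
by apply: weakly_regular_ext regs => p; exact: adjoin_swap.
Qed.

End Permutation.

(** * Elementary symmetric polynomials as a universal regular sequence *)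

Section UniversalSequence.
Variables (K : fieldType) (n : nat).
Local Notation S := {mpoly K[n]}.
Implicit Types (A B F T W : {set 'I_n}) (D : {set {set 'I_n}}) (v : 'I_n).

Definition esyms (r : nat) : seq S := [seq mesym n K i.+1 | i <- iota 0 r].

Lemma size_esyms r : size (esyms r) = r.
Proof. by rewrite size_map size_iota. Qed.

Lemma esyms_rcons r : esyms r.+1 = rcons (esyms r) (mesym n K r.+1).
Proof. by rewrite /esyms -{1}addn1 iotaD map_cat /= cats1. Qed.

Lemma esyms_homog r t : t \in esyms r -> exists k, t \is k.-homog.
Proof. by case/mapP=> i _ ->; exists i.+1; exact: dhomog_mesym. Qed.

Lemma weakly_regular_esyms_le (I : S -> Prop) r r' : (r' <= r)%N ->
  weakly_regular I (esyms r) -> weakly_regular I (esyms r').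
Proof.
elim: r => [|r IHr]; first by rewrite leqn0 => /eqP ->.
rewrite leq_eqVlt ltnS => /predU1P[-> //|/IHr H].
by rewrite esyms_rcons => /weakly_regular_rcons[/H].
Qed.

Lemma homogeneous_SR D : homogeneous_ideal (SR D : S -> Prop).
Proof.
move=> d p Ip m mD; rewrite pihomogE raddf_sum /= big1_seq // => k _.
rewrite mcoeffZ mcoeffX; case: (k =P m) => [->|_]; last by rewrite mulr0.
by rewrite (Ip m mD) mul0r.
Qed.

Lemma down_closed_powerset F : down_closed (powerset F).
Proof. by move=> A B sAB; rewrite !inE; exact: subset_trans. Qed.

Lemma nonzerodivisor_prod (I : S -> Prop) (s : seq 'I_n) (f : 'I_n -> S) :
  (forall i, i \in s -> nonzerodivisor_mod I (f i)) ->
  nonzerodivisor_mod I (\prod_(i <- s) f i).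
Proof.
elim: s => [|i s IHs] H p; first by rewrite big_nil mul1r.
rewrite big_cons -mulrA => /(H i (mem_head _ _)); apply: IHs => j js.
by apply: H; rewrite inE js orbT.
Qed.

Lemma mesym1_prod F : 'X_[mesym1 F] = \prod_(i in F) 'X_i :> S.
Proof.
rewrite mprodXE; congr 'X_[_]; apply/mnmP=> i.
rewrite mnmE mnm_sumE big_mkcond (bigD1 i) //= mnm1E eqxx big1 ?addn0 => [|j ne].
  by case: (i \in F).
by case: ifP => // _; rewrite mnm1E (negbTE ne).
Qed.

(** The polynomial ring on the variables of [F].  Killing one variable [x_v]
    leaves the ring on [F :\ v], so by permutation [x_v] is a nonzerodivisor
    after the first [#|F| - 1] elementary symmetric polynomials; and the last
    one restricts to the product of all the variables of [F]. *)
Lemma weakly_regular_simplex F :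
  weakly_regular (SR (powerset F) : S -> Prop) (esyms #|F|).
Proof.
move: {2}#|F| (erefl #|F|) => k Fk.
elim: k F Fk => [|k IHk] F Fk; rewrite Fk //.
have idF := SR_ideal K (@down_closed_powerset F).
have step v : v \in F ->
    weakly_regular (SR (powerset F) : S -> Prop) (esyms k) /\
    nonzerodivisor_mod (adjoins (SR (powerset F)) (esyms k)) 'X_v.
  move=> vF; apply: weakly_regular_permute => //.
  - exact: homogeneous_SR.
  - by rewrite dhomogX; apply/eqP; exact: mdeg1.
  - exact: esyms_homog.
  - move=> p; rewrite -mesym1_set1 => /colon_SR H m; rewrite inE => mF.
    by apply: H; rewrite !inE subUset mF sub1set.
  - have Fv : #|F :\ v| = k by move: Fk; rewrite (cardsD1 v) vF => -[].
    have := IHk _ Fv; rewrite Fv; apply: weakly_regular_ext => p.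
    rewrite -mesym1_set1.
    suff -> : powerset (F :\ v) =
        [set A in powerset F | ~~ ([set v] \subset A)].
      by split=> /adjoin_SR.
    by apply/setP=> A; rewrite !inE subsetD1 sub1set.
have [v vF] : exists v, v \in F by apply/card_gt0P; rewrite Fk.
rewrite esyms_rcons; apply/weakly_regular_rcons; split.
  by have [] := step v vF.
have idA := adjoins_ideal (esyms k) idF.
have Eprod : adjoins (SR (powerset F)) (esyms k)
    (mesym n K k.+1 - \prod_(i <- enum F) 'X_i).
  apply: sub_adjoins => //; rewrite mesymE (bigD1 F) /= ?Fk //.
  rewrite big_enum /= -mesym1_prod addrAC subrr add0r.
  apply: (ideal_sum idF) => A /andP[/eqP Ak neA].
  apply/SR_monomial; rewrite inE; apply: contra neA => sAF.
  by rewrite eqEcard sAF Ak Fk leqnn.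
(* Each variable of [F] can be taken for [v], so their product is regular. *)
have nzp : nonzerodivisor_mod (adjoins (SR (powerset F)) (esyms k))
    (\prod_(i <- enum F) 'X_i).
  by apply: nonzerodivisor_prod => i; rewrite mem_enum => /step[].
move=> p H; apply: nzp.
have := idealB idA H (ideal_mull idA p Eprod); congr (adjoins _ _ _); ring.
Qed.

(** The colon ideal by the variable of [v] is the ideal of the cone over the link
    of [v], and adding this variable gives the ideal of the deletion of [v]. *)
Lemma weakly_regular_link_deletion D v s : down_closed D ->
  weakly_regular (SR [set A | v |: A \in D] : S -> Prop) s ->
  weakly_regular (SR [set A in D | v \notin A] : S -> Prop) s ->
  weakly_regular (SR D : S -> Prop) s.
Proof.
move=> dD Hl Hd; apply: (@weakly_regular_colon_adjoin _ _ 'X_[mesym1 [set v]]).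
- exact: SR_ideal.
- apply: weakly_regular_ext Hl => p.
  suff -> : [set A | v |: A \in D] = [set A | A :|: [set v] \in D].
    by split=> /colon_SR.
  by apply/setP=> A; rewrite !inE setUC.
- apply: weakly_regular_ext Hd => p.
  suff -> : [set A in D | v \notin A] = [set A in D | ~~ ([set v] \subset A)].
    by split=> /adjoin_SR.
  by apply/setP=> A; rewrite !inE sub1set.
Qed.

(** The case of interest is [T = set0], [W = setT]: a complex that contains every
    set of at most [r] vertices.  The induction removes the vertices of [W] one
    by one; passing to the link of a vertex turns it into a cone point, and [T]
    collects the cone points. *)
Lemma weakly_regular_skeleton D T W r : down_closed D ->
  (r <= #|T| + #|W|)%N ->
  (forall A, A \in D -> A \subset T :|: W) ->
  (forall A, A \in D -> A :|: T \in D) ->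
  (forall A, A \subset W -> (#|A| + #|T| <= r)%N -> A \in D) ->
  [disjoint T & W] ->
  weakly_regular (SR D : S -> Prop) (esyms r).
Proof.
move: {2}#|W| (erefl #|W|) => k.
elim: k D T W => [|k IHk] D T W Wk dD le_r DTW cone skel dTW; last first.
  have [v vW] : exists v, v \in W by apply/card_gt0P; rewrite Wk.
  have vT : v \notin T by apply: contraTN vW => /(disjointFr dTW) ->.
  have Wv : #|W :\ v| = k by move: Wk; rewrite (cardsD1 v) vW => -[].
  have Tv : #|v |: T| = #|T|.+1 by rewrite cardsU1 vT.
  have dTv : [disjoint T & W :\ v].
    by apply: disjointWr dTW; exact: subsetDl.
  (* Deleting [v] keeps enough vertices, unless all of [W] is a face already. *)
  have [le_r'|] := leqP r (#|T| + k)%N; last first.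
    rewrite -ltnS -addnS -Wk => lt_r.
    have Dall : D = powerset (T :|: W).
      apply/setP=> A; rewrite inE; apply/idP/idP; first exact: DTW.
      by move=> sA; apply: dD sA _; rewrite setUC; apply/cone/skel => //; lia.
    rewrite Dall; apply: weakly_regular_esyms_le (weakly_regular_simplex _).
    by rewrite cardsU (disjoint_setI0 dTW) cards0 subn0.
  apply: (weakly_regular_link_deletion (v := v)) => //.
  - apply: (IHk _ (v |: T) (W :\ v)) => //.
    + by move=> A B sAB; rewrite !inE; apply: dD; exact: setUS.
    + by rewrite Tv Wv addSn; apply: leqW.
    + move=> A; rewrite inE => /DTW sA.
      apply: subset_trans (subset_trans sA _); first exact: subsetUr.
      by apply/subsetP=> i; rewrite !inE; case: eqP => //= _ ->.
    + by move=> A; rewrite !inE => /cone; congr (_ \in D);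
        apply/setP=> i; rewrite !inE; do !case: (_ \in _); do !case: (_ == _).
    + move=> A sA; rewrite inE Tv => le; apply: skel.
        rewrite subUset sub1set vW; apply: subset_trans sA _; exact: subsetDl.
      apply: leq_trans le; rewrite addnS -addSn leq_add2r cardsU1.
      by case: (v \notin A).
    + rewrite disjoint_sym disjoints_subset; apply/subsetP=> i; rewrite !inE.
      by case/andP=> nv /(disjointFl dTW) ->; rewrite orbF.
  - apply: (IHk _ T (W :\ v)) => //.
    + move=> A B sAB; rewrite !inE => /andP[DB vB]; rewrite (dD _ _ sAB DB).
      by apply: contra vB; exact: (subsetP sAB).
    + by rewrite Wv.
    + move=> A; rewrite inE => /andP[/DTW sA vA]; apply/subsetP=> i iA.
      have := subsetP sA i iA; rewrite !inE => /orP[->//|->].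
      by rewrite andbT; apply/orP; right; apply: contraNneq vA => <-.
    + by move=> A; rewrite !inE (negbTE vT) orbF => /andP[/cone -> ->].
    + move=> A sA le; rewrite inE skel //=.
        by apply/negP=> /(subsetP sA); rewrite !inE eqxx.
      by apply: subset_trans sA _; exact: subsetDl.
have W0 : W = set0 by apply/eqP; rewrite -cards_eq0 Wk.
have [D0|[A AD]] := set_0Vmem D.
  apply: weakly_regular_unit_ideal; first exact: SR_ideal.
  by move=> p m; rewrite D0 inE.
have Dall : D = powerset T.
  apply/setP=> B; rewrite inE; apply/idP/idP => [/DTW|sB].
    by rewrite W0 setU0.
  by apply: (dD _ _ _ (cone _ AD)); apply: subset_trans sB (subsetUr _ _).
rewrite Dall; apply: weakly_regular_esyms_le (weakly_regular_simplex _).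
by rewrite Wk addn0 in le_r.
Qed.

End UniversalSequence.

(** * Koszul cochains *)

(** Antisymmetry alone does not suffice in characteristic 2, hence the
    hypothesis on the diagonal. *)
Lemma sum_alternating (R : comNzRingType) (n : nat) (F : 'I_n -> 'I_n -> R) :
  (forall i, F i i = 0) -> (forall i j, i != j -> F i j = - F j i) ->
  \sum_i \sum_j F i j = 0.
Proof.
move=> F0 FN; rewrite pair_big /= (bigID (fun u : 'I_n * 'I_n => u.1 < u.2)%N) /=.
rewrite [X in _ + X](bigID (fun u : 'I_n * 'I_n => u.2 < u.1)%N) /=.
rewrite [X in _ + (_ + X)]big1.
  rewrite addr0 [X in _ + X](reindex_inj (h := fun u : 'I_n * 'I_n => (u.2, u.1))) /=.
    rewrite [X in _ + X](eq_bigl (fun u : 'I_n * 'I_n => u.1 < u.2)%N) => [|u].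
      by rewrite -big_split big1 //= => u lt; rewrite FN ?addNr // neq_ltn lt.
    by rewrite -leqNgt; apply: andb_idl => /ltnW.
  by move=> [a b] [c d] [-> ->].
by move=> [i j] /=; rewrite -!leqNgt -eqn_leq => /eqP/val_inj ->.
Qed.

Section Koszul.
Variables (R : comNzRingType) (n : nat).
Implicit Types (c b : {set 'I_n} -> R) (A B Z : {set 'I_n}) (i j : 'I_n).
Implicit Types (v w x g : 'I_n -> R).

Definition ksign i A : R := \prod_(j in A) (-1) ^+ (j < i)%N.

(** Exterior multiplication by, and contraction with, the [i]-th basis
    vector, on the coordinates of an element of the exterior algebra. *)
Definition wedge i c A : R := if i \in A then ksign i A * c (A :\ i) else 0.
Definition contract i c A : R := if i \in A then 0 else ksign i A * c (i |: A).

Definition kdiff w c A : R := \sum_i w i * wedge i c A.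
Definition khomotopy g c A : R := \sum_i g i * contract i c A.

Lemma ksignD1 i j A : j \in A -> ksign i A = (-1) ^+ (j < i)%N * ksign i (A :\ j).
Proof. by move=> jA; rewrite /ksign (big_setD1 j). Qed.

Lemma ksignU1 i j A :
  j \notin A -> ksign i (j |: A) = (-1) ^+ (j < i)%N * ksign i A.
Proof. by move=> jA; rewrite (@ksignD1 i j) ?setU11 // setU1K. Qed.

Lemma ksign_sq i A : ksign i A * ksign i A = 1.
Proof.
by rewrite /ksign -big_split big1 //= => j _; rewrite -expr2 sqrr_sign.
Qed.

Lemma sign_ltn_swap i j : i != j -> (-1) ^+ (j < i)%N = - (-1) ^+ (i < j)%N :> R.
Proof.
by rewrite neq_ltn => /orP[] lt; rewrite lt ltnNge (ltnW lt) /= ?expr1 ?opprK.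
Qed.

Lemma wedge_anti i j c A : i != j -> wedge i (wedge j c) A = - wedge j (wedge i c) A.
Proof.
move=> ne; rewrite /wedge !inE (eq_sym j) ne /=.
case iA: (i \in A); case jA: (j \in A); rewrite ?mulr0 ?oppr0 //.
rewrite (ksignD1 i jA) (ksignD1 j iA) (sign_ltn_swap ne).
have -> : A :\ i :\ j = A :\ j :\ i by apply/setP=> k; rewrite !inE andbCA.
by ring.
Qed.

Lemma wedgeii i c A : wedge i (wedge i c) A = 0.
Proof. by rewrite /wedge setD11 mulr0 if_same. Qed.

Lemma wedge_contract i c A :
  wedge i (contract i c) A + contract i (wedge i c) A = c A.
Proof.
rewrite /wedge /contract setD11 setU11; case: ifP => iA.
  rewrite addr0 setD1K // (ksignD1 i iA) ltnn expr0 mul1r mulrA ksign_sq.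
  by rewrite mul1r.
by rewrite add0r setU1K ?iA // ksignU1 ?iA // ltnn mul1r mulrA ksign_sq mul1r.
Qed.

Lemma wedge_contract_anti i j c A : i != j ->
  wedge i (contract j c) A + contract j (wedge i c) A = 0.
Proof.
move=> ne; rewrite /wedge /contract !inE (eq_sym j) (negbTE ne) /=.
case iA: (i \in A); case jA: (j \in A); rewrite ?mulr0 ?addr0 //.
rewrite (ksignD1 j iA) ksignU1 ?jA // (sign_ltn_swap ne).
have -> : j |: A :\ i = (j |: A) :\ i.
  by apply/setP=> k; rewrite !inE; case: (k =P j) => // ->; rewrite eq_sym ne.
have e2 : (-1) ^+ (i < j)%N * (-1) ^+ (i < j)%N = 1 :> R.
  by rewrite -expr2 sqrr_sign.
by ring: e2.
Qed.

Lemma wedge_sum i (F : 'I_n -> {set 'I_n} -> R) A :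
  wedge i (fun B => \sum_j F j B) A = \sum_j wedge i (F j) A.
Proof.
rewrite /wedge; case: ifP => _; last by rewrite big1.
by rewrite mulr_sumr.
Qed.

Lemma wedgeZ i a c A : wedge i (fun B => a * c B) A = a * wedge i c A.
Proof. by rewrite /wedge; case: ifP => _; rewrite ?mulr0 // mulrCA. Qed.

Lemma kdiff2E v w c A :
  kdiff v (kdiff w c) A = \sum_i \sum_j v i * w j * wedge i (wedge j c) A.
Proof.
apply: eq_bigr => i _; rewrite wedge_sum mulr_sumr; apply: eq_bigr => j _.
by rewrite wedgeZ mulrA.
Qed.

Lemma kdiffK w c A : kdiff w (kdiff w c) A = 0.
Proof.
rewrite kdiff2E; apply: sum_alternating => [i|i j ne]; first by rewrite wedgeii mulr0.
by rewrite wedge_anti // mulrN (mulrC (w i)).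
Qed.

(** Multiplication by an element of the ideal generated by the [w i] is
    homotopic to zero on the Koszul complex. *)
Lemma kdiff_homotopy w g c A :
  kdiff w (khomotopy g c) A + khomotopy g (kdiff w c) A =
  (\sum_i w i * g i) * c A.
Proof.
have contract_sum i (F : 'I_n -> {set 'I_n} -> R) :
    contract i (fun B => \sum_j F j B) A = \sum_j contract i (F j) A.
  rewrite /contract; case: ifP => _; first by rewrite big1.
  by rewrite mulr_sumr.
have contractZ i a c' : contract i (fun B => a * c' B) A = a * contract i c' A.
  by rewrite /contract; case: ifP => _; rewrite ?mulr0 // mulrCA.
have -> : kdiff w (khomotopy g c) A =
    \sum_i \sum_j w i * g j * wedge i (contract j c) A.
  apply: eq_bigr => i _; rewrite wedge_sum mulr_sumr; apply: eq_bigr => j _.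
  by rewrite wedgeZ mulrA.
have -> : khomotopy g (kdiff w c) A =
    \sum_i \sum_j w i * g j * contract j (wedge i c) A.
  rewrite exchange_big; apply: eq_bigr => j _ /=.
  rewrite contract_sum mulr_sumr; apply: eq_bigr => i _.
  by rewrite contractZ mulrA (mulrC (g j)).
rewrite -big_split mulr_suml; apply: eq_bigr => i _ /=.
rewrite -big_split (bigD1 i) //= -mulrDr wedge_contract big1 ?addr0 // => j ne.
by rewrite -mulrDr wedge_contract_anti ?mulr0 // eq_sym.
Qed.

Lemma kdiff_congr (I : R -> Prop) w c c' A : is_ideal I ->
  (forall B, (#|B| < #|A|)%N -> I (c B - c' B)) ->
  I (kdiff w c A - kdiff w c' A).
Proof.
move=> idI H; rewrite -sumrB; apply: ideal_sum => // i _; rewrite -mulrBr.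
apply: ideal_mull => //; rewrite /wedge; case: ifP => iA; last first.
  by rewrite subrr; exact: ideal0.
rewrite -mulrBr; apply: ideal_mull => //; apply: H.
by rewrite [X in (_ < X)%N](cardsD1 i) iA ltnS.
Qed.

(** The Koszul cohomology of [R/I] vanishes below the length of a regular
    sequence from [(x)].  Multiplication by [t = \sum_i x_i g_i] is null
    homotopic, so a cocycle [c] satisfies [t c = d b]; then [b] is a cocycle
    modulo [I + t], and correcting [b] by a coboundary there makes it
    divisible by [t]. *)
Lemma koszul_vanishing (I : R -> Prop) x (f : seq R) : is_ideal I ->
  (forall t, t \in f -> exists g, t = \sum_i x i * g i) ->
  weakly_regular I f ->
  forall c, (forall A, (#|A| <= size f)%N -> I (kdiff x c A)) ->
  exists b, forall A, (#|A| < size f)%N -> I (c A - kdiff x b A).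
Proof.
elim: f I => [|t f IHf] I idI Hx /=; first by move=> _ c _; exists c.
move=> [nzt regf] c Hc.
have [g tE] := Hx t (mem_head _ _).
pose b := khomotopy g c.
have tcb A : (#|A| <= size f)%N -> I (t * c A - kdiff x b A).
  move=> leA; rewrite tE -kdiff_homotopy addrAC subrr add0r.
  apply: ideal_sum => // i _; apply: ideal_mull => //; rewrite /contract.
  case: ifP => iA; first exact: ideal0.
  by apply: ideal_mull => //; apply: Hc; rewrite cardsU1 iA add1n ltnS.
have idIt := adjoin_ideal idI t.
have [||b' Hb'] := IHf (adjoin I t) idIt _ regf b.
- by move=> u uf; apply: Hx; rewrite inE uf orbT.
- move=> A leA; exists (c A).
  by have := idealN idI (tcb A leA); congr I; ring.
have : forall A, exists q, (#|A| < size f)%N -> I (b A - kdiff x b' A - t * q).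
  move=> A; case: (ltnP #|A| (size f)) => [/Hb'[q Hq]|_]; first by exists q.
  by exists 0.
case/fin_all_exists => b2 Hb2; exists b2 => A; rewrite ltnS => leA.
apply: nzt.
have : I (kdiff x b A - kdiff x (fun B => kdiff x b' B + t * b2 B) A).
  apply: kdiff_congr => // B ltB; rewrite opprD addrA; apply: Hb2.
  exact: leq_trans ltB leA.
have -> : kdiff x (fun B => kdiff x b' B + t * b2 B) A = t * kdiff x b2 A.
  have -> : kdiff x (fun B => kdiff x b' B + t * b2 B) A =
      kdiff x (kdiff x b') A + t * kdiff x b2 A.
    rewrite /kdiff mulr_sumr -big_split; apply: eq_bigr => i _ /=.
    by rewrite /wedge; case: ifP => _; rewrite ?mulr0 ?addr0 //; ring.
  by rewrite kdiffK add0r.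
move=> H; have := idealD idI (tcb A leA) H; congr I; ring.
Qed.

End Koszul.

(** * Upper bounds for regular sequences modulo a Stanley-Reisner ideal *)

Section UpperBounds.
Variables (K : fieldType) (n : nat).
Local Notation S := {mpoly K[n]}.
Implicit Types (A B C U F Z : {set 'I_n}) (D : {set {set 'I_n}}) (i j : 'I_n).
Implicit Types (f : seq S) (I : S -> Prop).

Definition in_max_ideal (t : S) : Prop := exists g, t = \sum_i 'X_i * g i.

Lemma in_max_ideal_coef0 (t : S) : in_max_ideal t -> t@_0%MM = 0.
Proof.
case=> g ->; rewrite raddf_sum /= big1 // => i _.
apply: mcoeffM_eq0 => k1 k2 E; rewrite mcoeffX; case: eqP => [Ek|]; last first.
  by rewrite mul0r.
by move/mnmP/(_ i): E; rewrite mnmDE -Ek mnm1E eqxx mnm0E.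
Qed.

(** The Koszul cohomology in degree [n] is [S / (I + (x_1, .., x_n))], which is
    nonzero: the constant 1 represents a nontrivial class. *)
Lemma size_regular_le I f : is_ideal I ->
  (forall p, I p -> p@_0%MM = 0) -> (forall t, t \in f -> in_max_ideal t) ->
  weakly_regular I f -> (size f <= n)%N.
Proof.
move=> idI I0 Hf regf; rewrite leqNgt; apply/negP => lt_n.
pose c A : S := if A == setT then 1 else 0.
have [|b Hb] := koszul_vanishing idI Hf regf (c := c).
  move=> A _; rewrite /kdiff big1 => [|i _]; first exact: ideal0.
  rewrite /wedge /c; case: ifP => iA; last by rewrite mulr0.
  case: eqP => [E|_]; last by rewrite !mulr0.
  by have := in_setT i; rewrite -E setD11.
have := Hb setT; rewrite cardsT card_ord => /(_ lt_n)/I0.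
rewrite mcoeffB /c eqxx mcoeff1 eqxx [X in _ - X]in_max_ideal_coef0.
  by rewrite subr0 => /eqP; rewrite oner_eq0.
by exists (fun i => wedge i b setT).
Qed.

Definition kdelta Z B : K := (B == Z)%:R.

Lemma wedge2_kdelta_eq0 Z A i j : ~~ [&& i \notin Z, j \notin Z, i != j &
    A == i |: (j |: Z)] -> wedge i (wedge j (kdelta Z)) A = 0.
Proof.
move=> H; rewrite /wedge; case: ifP => iA //; case: ifP => jA; last by rewrite mulr0.
rewrite /kdelta; case: eqP => [E|_]; last by rewrite !mulr0.
case/negP: H; rewrite -E setD1K // setD1K // eqxx andbT !inE !eqxx /=.
by move: jA; rewrite !inE andbF eq_sym => /andP[->].
Qed.

Lemma wedge2_kdelta_neq0 Z i j : i \notin Z -> j \notin Z -> i != j ->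
  wedge i (wedge j (kdelta Z)) (i |: (j |: Z)) != 0.
Proof.
move=> iZ jZ ne; have iN : i \notin j |: Z by rewrite !inE negb_or ne.
rewrite /wedge setU11 setU1K // setU11 setU1K // /kdelta eqxx mulr1.
have sq k B : ksign K k B != 0.
  apply/negP=> /eqP H; have := ksign_sq K k B; rewrite H mul0r => /eqP.
  by rewrite eq_sym oner_eq0.
by rewrite mulf_neq0.
Qed.

Lemma mcoeffXM i (q : S) C :
  ('X_i * q)@_(mesym1 C) = if i \in C then q@_(mesym1 (C :\ i)) else 0.
Proof.
case: ifP => iC.
  have -> : mesym1 C = (U_(i) + mesym1 (C :\ i))%MM.
    apply/mnmP=> k; rewrite mnmDE mnm1E !mnmE !inE eq_sym.
    by case: eqP => [->|_]; rewrite ?iC.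
  by rewrite mulrC mcoeffMX.
apply: mcoeffM_eq0 => k1 k2 E; rewrite mcoeffX; case: eqP => [Ek|]; last first.
  by rewrite mul0r.
by move/mnmP/(_ i): E; rewrite mnmDE -Ek mnm1E eqxx mnmE iC.
Qed.

Lemma ksignC i A : ksign S i A = (ksign K i A)%:MP.
Proof.
rewrite /ksign rmorph_prod; apply: eq_bigr => j _.
by rewrite rmorphXn /= mpolyCN mpolyC1.
Qed.

(** If the link of [F] in the restriction of [D] to the complement of [U] is
    disconnected, with [A'] one side of a separation, then the cochain that is
    supported on the sets [U :|: F :|: [set a]] with [a] in [A'] is a Koszul
    cocycle modulo the ideal of [D].  It is no coboundary, because every set of
    [#|F| + 1] elements outside [U] is a face: reading off coefficients would
    make it a coboundary over [K] even across the nonfaces [F :|: [set a; b]]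
    with [b] on the other side, where its differential is nonzero. *)
Lemma size_regular_separated D U F A' f a0 b0 : down_closed D ->
  [disjoint U & F] ->
  a0 \in A' -> b0 \notin U :|: F :|: A' -> [disjoint A' & U :|: F] ->
  (forall a b, a \in A' -> b \notin U :|: F :|: A' -> a |: (b |: F) \notin D) ->
  (forall B, [disjoint B & U] -> (#|B| <= #|F|.+1)%N -> B \in D) ->
  (forall t, t \in f -> in_max_ideal t) ->
  weakly_regular (SR D : S -> Prop) f ->
  (size f <= #|U| + #|F| + 1)%N.
Proof.
move=> dD dUF a0A b0N dAZ sep skel Hf regf; rewrite leqNgt; apply/negP => lt_f.
set Z := U :|: F in b0N dAZ sep.
have idD := SR_ideal K dD.
have Zc : #|Z| = (#|U| + #|F|)%N.
  by rewrite /Z cardsU (disjoint_setI0 dUF) cards0 subn0.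
(* On cochains [A |-> g A *: x_(A :\: U)] with [g] supported on the sets containing
   [U], the Koszul differential acts on the coefficients [g] as [kdiff u]. *)
pose w i : K := (i \in A')%:R; pose u i : K := (i \notin U)%:R.
pose gam := kdiff w (kdelta Z).
pose c A : S := (gam A) *: 'X_[mesym1 (A :\: U)].
have gam_U A i : i \in U -> i \notin A -> gam A = 0.
  move=> iU iA; rewrite /gam /kdiff big1 // => j _; rewrite /wedge.
  case: ifP => jA; last by rewrite mulr0.
  rewrite /kdelta; case: eqP => [E|_]; last by rewrite !mulr0.
  have : i \in Z by rewrite inE iU.
  by rewrite -E !inE (negbTE iA) andbF.
have ugam A : A :\: U \in D -> kdiff u gam A = 0.
  move=> AD; rewrite /gam.
  have -> : kdiff u (kdiff w (kdelta Z)) A =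
     kdiff w (kdiff w (kdelta Z)) A +
     kdiff (fun i => u i - w i) (kdiff w (kdelta Z)) A.
    by rewrite /kdiff -big_split; apply: eq_bigr => i _ /=; ring.
  rewrite kdiffK add0r kdiff2E big1 // => i _; rewrite big1 // => j _.
  have [jA|jA] := boolP (j \in A'); last by rewrite /w (negbTE jA) mulr0 mul0r.
  have [iA|iA] := boolP (i \in A').
    rewrite /u /w iA; have -> : i \notin U.
      by have := disjointFr dAZ iA; rewrite !inE => /norP[].
    by rewrite subrr !mul0r.
  apply/eqP; rewrite mulf_eq0; apply/orP; right; apply/eqP.
  apply: wedge2_kdelta_eq0; apply/negP => /and4P[iZ jZ ne /eqP AE].
  have := sep j i jA; rewrite in_setU negb_or iZ iA => /(_ isT) /negP; apply.
  apply: dD AD; apply/subsetP=> k kB; rewrite inE AE; apply/andP; split.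
    move: kB; rewrite !inE => /or3P[/eqP->|/eqP->|kF].
    - by move: jZ; rewrite inE negb_or => /andP[].
    - by move: iZ; rewrite inE negb_or => /andP[].
    - by rewrite (disjointFl dUF kF).
  by move: kB; rewrite !inE => /or3P[->|->|->]; rewrite ?orbT.
have [A _|b Hb] := koszul_vanishing idD Hf regf (c := c).
  have -> : kdiff (fun i => 'X_i) c A =
      (kdiff u gam A) *: 'X_[mesym1 (A :\: U)].
    rewrite /kdiff scaler_suml; apply: eq_bigr => i _; rewrite /wedge.
    case: ifP => iA; last by rewrite !mulr0 scale0r.
    rewrite /u /c; have [iU|iU] := boolP (i \in U).
      by rewrite (gam_U _ i iU) ?setD11 // !(scale0r, mulr0).
    rewrite mul1r ksignC mul_mpolyC scalerA -scalerAr; congr (_ *: _).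
    rewrite -mpolyXD; congr 'X_[_]; apply/mnmP=> k.
    rewrite mnmDE mnm1E !mnmE !inE eq_sym; case: eqP => [->|_] //=.
    by rewrite iU iA.
  have [AD|AD] := boolP (A :\: U \in D).
    by rewrite ugam // scale0r; exact: ideal0.
  rewrite -mul_mpolyC; apply: (ideal_mull idD); exact/SR_monomial.
(* A cochain bounding [c] would, on coefficients, bound [gam] over [K]. *)
pose bet A : K := if U \subset A then (b A)@_(mesym1 (A :\: U)) else 0.
have gamE A : (#|A| <= #|Z|.+1)%N -> gam A = kdiff u bet A.
  move=> leA; have [UA|UA] := boolP (U \subset A); last first.
    have /subsetPn[i iU iA] := UA; rewrite (gam_U A i) //.
    rewrite /kdiff big1 // => j _; rewrite /wedge; case: ifP => jA; last first.
      by rewrite mulr0.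
    rewrite /bet ifN ?mulr0 //; apply: contra UA => sU.
    by apply: subset_trans sU (subsetDl _ _).
  have AD : A :\: U \in D.
    apply: skel; first by rewrite disjoint_sym disjoints_subset setCD subsetUr.
    by rewrite cardsD (setIidPr UA); lia.
  have lt_A : (#|A| < size f)%N.
    by apply: leq_ltn_trans leA _; rewrite Zc -addn1.
  have := Hb A lt_A (mesym1 (A :\: U)); rewrite mnm_supp_mesym1 => /(_ AD) /eqP.
  rewrite mcoeffB mcoeffZ mcoeffX eqxx mulr1 subr_eq0 => /eqP ->.
  rewrite /kdiff raddf_sum /=; apply: eq_bigr => i _; rewrite mcoeffXM !inE /u.
  case: (boolP (i \in U)) => iU; first by rewrite mul0r.
  rewrite /wedge; case: (boolP (i \in A)) => iA /=; last by rewrite mulr0.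
  rewrite mul1r ksignC mcoeffCM /bet subsetD1 UA iU; congr (_ * _@_(mesym1 _)).
  by apply/setP=> k; rewrite !inE andbCA.
have a0Z : a0 \notin Z by rewrite (disjointFr dAZ).
move: (b0N); rewrite in_setU negb_or => /andP[b0Z b0A].
have ne : b0 != a0 by apply: contraNneq b0A => ->.
have b0U : b0 \notin U by move: b0Z; rewrite inE negb_or => /andP[].
clearbody Z.
(* Hence [gam] would be a cocycle also at this nonface, where the only nonzero
   term of its differential removes [b0]. *)
have : kdiff u gam (b0 |: (a0 |: Z)) = 0.
  rewrite -(kdiffK u bet (b0 |: (a0 |: Z))); apply: eq_bigr => i _.
  congr (_ * _); rewrite /wedge; case: ifP => // iA; rewrite gamE //.
  have := cardsD1 i (b0 |: (a0 |: Z)); rewrite iA cardsU1 cardsU1.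
  by rewrite a0Z !inE negb_or ne b0Z; rewrite !add1n => -[<-].
rewrite kdiff2E (bigD1 b0) //= (bigD1 a0) //= big1 => [|j nej].
  rewrite big1 => [|i nei].
    rewrite !addr0 /u /w b0U a0A !mul1r => /eqP.
    by rewrite (negbTE (wedge2_kdelta_neq0 _ _ _)).
  rewrite big1 // => j _; have [jA|jA] := boolP (j \in A'); last first.
    by rewrite /w (negbTE jA) mulr0 mul0r.
  rewrite wedge2_kdelta_eq0 ?mulr0 //; apply/negP=> /and4P[iZ jZ neij /eqP E].
  have : b0 \in i |: (j |: Z) by rewrite -E setU11.
  rewrite !inE (eq_sym b0) (negbTE nei) /= (negbTE b0Z) orbF => /eqP b0j.
  by rewrite b0j jA in b0A.
rewrite wedge2_kdelta_eq0 ?mulr0 //; apply/negP=> /and4P[iZ jZ neij /eqP E].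
have : a0 \in b0 |: (j |: Z) by rewrite -E !inE eqxx orbT.
by rewrite !inE (eq_sym a0) (negbTE ne) (eq_sym a0) (negbTE nej) (negbTE a0Z).
Qed.

End UpperBounds.

(** * Depth through weakly regular sequences *)

Lemma max_natP (P : nat -> Prop) b : P 0%N -> (forall j, P j -> (j <= b)%N) ->
  is_max P (max_nat P).
Proof.
move=> P0 Pb; apply: (epsilon_spec (inhabits 0%N) (is_max P)).
elim: b Pb => [|b IHb] Pb; first by exists 0%N; split.
have [Pb1|NPb] := classic (P b.+1); first by exists b.+1; split.
apply: IHb => j Pj; have := Pb j Pj; rewrite leq_eqVlt => /predU1P[E|//].
by rewrite E in Pj.
Qed.

Lemma min_natE (P : nat -> Prop) d : is_min P d -> min_nat P = d.
Proof.
move=> [Pd mind]; have [Pm minm] : is_min P (min_nat P).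
  by apply: (epsilon_spec (inhabits 0%N) (is_min P)); exists d.
by apply/eqP; rewrite eqn_leq minm // mind.
Qed.

Section Depth.
Variables (K : fieldType) (n : nat).
Local Notation S := {mpoly K[n]}.
Implicit Types (I J A : S -> Prop) (f : seq S) (p q : S).

Lemma ideal_gen_ideal A : is_ideal (ideal_gen A).
Proof.
split.
- by exists [::]; rewrite big_nil; split.
- move=> p q [s [As ->]] [t [At ->]]; exists (s ++ t); rewrite big_cat; split=> //.
  by move=> u; rewrite mem_cat => /orP[/As|/At].
- move=> a p [s [As ->]]; exists [seq (a * u.1, u.2) | u <- s]; split.
    by move=> _ /mapP[u us ->]; exact: (As u us).
  by rewrite big_map mulr_sumr; apply: eq_bigr => u _; rewrite mulrA.
Qed.

Lemma mem_ideal_gen A p : A p -> ideal_gen A p.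
Proof.
move=> Ap; exists [:: (1, p)]; split; first by move=> u; rewrite inE => /eqP ->.
by rewrite big_seq1 mul1r.
Qed.

Lemma ideal_gen_min A I : is_ideal I -> (forall p, A p -> I p) ->
  forall p, ideal_gen A p -> I p.
Proof.
move=> idI AI p [s [As ->]]; rewrite big_seq; apply: ideal_sum => // u us.
by apply: (ideal_mull idI); apply: AI; exact: As.
Qed.

(** Adjoining all elements at once or one after the other is the same; this
    links the two notions of regular sequence. *)
Lemma add_idealE J f p : is_ideal J -> add_ideal J f p <-> adjoins J f p.
Proof.
move=> idJ; split.
  apply: ideal_gen_min; first exact: adjoins_ideal.
  move=> q [Jq|qf]; first exact: sub_adjoins.
  rewrite /adjoins; elim: f J idJ qf => // t f IHf J idJ.
  rewrite inE => /predU1P[->|qf] /=; last exact: IHf (adjoin_ideal idJ t) qf.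
  apply: sub_adjoins; first exact: adjoin_ideal.
  by rewrite -{2}[t]mulr1; exact: mem_adjoin.
have : forall q, J q -> add_ideal J f q by move=> q Jq; apply: mem_ideal_gen; left.
have : forall t, t \in f -> add_ideal J f t.
  by move=> t tf; apply: mem_ideal_gen; right.
have: is_ideal (add_ideal J f) by exact: ideal_gen_ideal.
move: (add_ideal J f) => I idI.
elim: f J {idJ} => [|t f IHf] J fI JI; first exact: JI.
apply: IHf => [u uf|q [r Hr]]; first by apply: fI; rewrite inE uf orbT.
rewrite -(subrK (t * r) q); apply: (idealD idI); first exact: JI.
by apply: (ideal_mulr idI); apply: fI; exact: mem_head.
Qed.

Lemma weakly_regular_nth I f : weakly_regular I f <->
  forall i, (i < size f)%N -> nonzerodivisor_mod (adjoins I (take i f)) f`_i.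
Proof.
rewrite /adjoins; elim: f I => [|t f IHf] I /=; first by [].
split=> [[nzt /IHf H] [|i] //|H]; first exact: H.
split; first exact: (H 0%N).
by apply/IHf => i lt_i; exact: (H i.+1).
Qed.

Lemma regular_seqE J f : is_ideal J ->
  regular_seq J f <-> ~ adjoins J f 1 /\ weakly_regular J f.
Proof.
move=> idJ; rewrite /regular_seq (add_idealE _ _ idJ) weakly_regular_nth.
by split=> -[N1 H]; split=> // i lt_i p /(add_idealE _ _ idJ) /(H i lt_i)
  /(add_idealE _ _ idJ).
Qed.

Lemma max_idealE (q : S) : max_ideal q <-> in_max_ideal q.
Proof.
split=> [|[g ->]]; last first.
  apply: ideal_sum => [|i _]; first exact: ideal_gen_ideal.
  apply: ideal_mulr; first exact: ideal_gen_ideal.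
  by apply: mem_ideal_gen; exists i.
apply: ideal_gen_min.
  split=> [|p r [g ->] [h ->]|a p [g ->]].
  - by exists (fun=> 0); rewrite big1 // => i _; rewrite mulr0.
  - exists (fun i => g i + h i); rewrite -big_split; apply: eq_bigr => i _.
    by rewrite /= mulrDr.
  - exists (fun i => a * g i); rewrite mulr_sumr; apply: eq_bigr => i _.
    by rewrite mulrCA.
move=> _ [i ->]; exists (fun j => (j == i)%:R).
rewrite (bigD1 i) //= eqxx mulr1 big1 ?addr0 // => j /negbTE ->.
by rewrite mulr0.
Qed.

Section ProperIdeal.
Variable J : S -> Prop.
Hypotheses (idJ : is_ideal J) (J0 : forall p, J p -> p@_0%MM = 0).

Lemma one_notin_adjoins f : (forall t, t \in f -> in_max_ideal t) ->
  ~ adjoins J f 1.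
Proof.
move=> Hf; suff H p : adjoins J f p -> p@_0%MM = 0.
  by move/H; rewrite mcoeff1 eqxx => /eqP; rewrite oner_eq0.
rewrite /adjoins; move: J J0; elim: f Hf => [|t f IHf] Hf I I0; first exact: I0.
apply: IHf => [u uf|q [r /I0]]; first by apply: Hf; rewrite inE uf orbT.
have /in_max_ideal_coef0 t0 := Hf t (mem_head _ _).
rewrite mcoeffB => /eqP; rewrite subr_eq0 => /eqP ->.
apply: mcoeffM_eq0 => k1 k2 /esym/eqP; rewrite mnmD_eq0.
by case/andP=> /eqP -> _; rewrite t0 mul0r.
Qed.

(** Lengths of regular sequences are bounded by [n], so the depth is an actual
    maximum; the condition that the sequence generates a proper ideal is
    automatic inside the maximal ideal. *)
Lemma depth_quotient_spec : is_max (fun r => exists f,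
  [/\ size f = r, forall t, t \in f -> in_max_ideal t & weakly_regular J f])
  (depth_quotient J).
Proof.
rewrite /depth_quotient.
have -> : (fun r => exists f, [/\ size f = r,
      forall q, q \in f -> max_ideal q & regular_seq J f]) =
    (fun r => exists f, [/\ size f = r,
      forall t, t \in f -> in_max_ideal t & weakly_regular J f]).
  apply: functional_extensionality => r; apply: propositional_extensionality.
  split=> -[f [fr Hf Hr]]; exists f; split=> //.
  - by move=> q /Hf /max_idealE.
  - by case/(regular_seqE _ idJ): Hr.
  - by move=> q /Hf /max_idealE.
  - by apply/(regular_seqE _ idJ); split=> //; exact: one_notin_adjoins.
apply: (max_natP (b := n)); first by exists [::].
by move=> r [f [<- Hf regf]]; exact: size_regular_le regf.
Qed.

Lemma depth_quotient_ge f : (forall t, t \in f -> in_max_ideal t) ->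
  weakly_regular J f -> (size f <= depth_quotient J)%N.
Proof. by move=> Hf regf; apply: depth_quotient_spec.2; exists f. Qed.

Lemma depth_quotient_le b :
  (forall f, (forall t, t \in f -> in_max_ideal t) -> weakly_regular J f ->
     (size f <= b)%N) ->
  (depth_quotient J <= b)%N.
Proof. by move=> H; case: depth_quotient_spec => -[f [<- Hf regf]] _; exact: H. Qed.

End ProperIdeal.

Lemma esyms_in_max_ideal r (t : S) : t \in esyms K n r -> in_max_ideal t.
Proof.
case/mapP=> i _ ->; apply/max_idealE; rewrite /mesym.
apply: ideal_sum => [|A /eqP Ai]; first exact: ideal_gen_ideal.
have [v vA] : exists v, v \in A by apply/card_gt0P; rewrite Ai.
rewrite (bigD1 v) //=; apply: ideal_mulr; first exact: ideal_gen_ideal.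
by apply: mem_ideal_gen; exists v.
Qed.

Lemma SR_coef0 (D : {set {set 'I_n}}) : set0 \in D ->
  forall p : S, SR D p -> p@_0%MM = 0.
Proof.
move=> D0 p; apply; suff -> : mnm_supp 0%MM = set0 :> {set 'I_n} by [].
by apply/setP=> i; rewrite !inE mnm0E.
Qed.

Lemma depth_SR_ge (D : {set {set 'I_n}}) r : down_closed D -> set0 \in D ->
  weakly_regular (SR D : S -> Prop) (esyms K n r) ->
  (r <= depth_quotient (SR D : S -> Prop))%N.
Proof.
move=> dD D0 reg; rewrite -(size_esyms K n r).
by apply: depth_quotient_ge reg; [exact: SR_ideal | exact: SR_coef0 |
  exact: esyms_in_max_ideal].
Qed.

Lemma depth_SR_le (D : {set {set 'I_n}}) (U F A' : {set 'I_n}) a0 b0 :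
  down_closed D ->
  [disjoint U & F] ->
  a0 \in A' -> b0 \notin U :|: F :|: A' -> [disjoint A' & U :|: F] ->
  (forall a b, a \in A' -> b \notin U :|: F :|: A' -> a |: (b |: F) \notin D) ->
  (forall B : {set 'I_n}, [disjoint B & U] -> (#|B| <= #|F|.+1)%N -> B \in D) ->
  (depth_quotient (SR D : S -> Prop) <= #|U| + #|F| + 1)%N.
Proof.
move=> dD dUF a0A b0N dA sep skel; apply: depth_quotient_le.
- exact: SR_ideal.
- by apply: SR_coef0; apply: skel; rewrite ?cards0 -?setI_eq0 ?set0I.
- by move=> f Hf; exact: (size_regular_separated dD dUF a0A b0N dA sep skel Hf).
Qed.

End Depth.

(** * Matchings inside a vertex set *)

Section Matchable.
Variables (T : finType) (e : rel T).
Implicit Types (X Y Z : {set T}) (M : {set {set T}}) (i j c : T) (k : nat).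

(** Deleting both ends of the chosen edge before the recursive call is what makes
    the [k] edges disjoint. *)
Fixpoint matchable k X : bool :=
  if k is k'.+1 then
    [exists i, exists j, [&& i \in X, j \in X, e i j & matchable k' (X :\ i :\ j)]]
  else true.

Lemma matchableS k X : reflect
  (exists i j, [/\ i \in X, j \in X, e i j & matchable k (X :\ i :\ j)])
  (matchable k.+1 X).
Proof.
apply: (iffP existsP) => [[i /existsP[j /and4P[]]]|[i [j [iX jX eij m]]]].
  by exists i, j.
by exists i; apply/existsP; exists j; apply/and4P.
Qed.

Lemma matchable_mono k X Y : X \subset Y -> matchable k X -> matchable k Y.
Proof.
elim: k X Y => // k IHk X Y sXY /matchableS[i [j [iX jX eij m]]].
apply/matchableS; exists i, j; split; rewrite ?(subsetP sXY) //.
by apply: IHk m; rewrite !setSD.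
Qed.

Lemma matchable_union k l X Y : [disjoint X & Y] ->
  matchable k X -> matchable l Y -> matchable (k + l) (X :|: Y).
Proof.
elim: k X => [|k IHk] X dXY; first by move=> _; apply: matchable_mono; exact: subsetUr.
move=> /matchableS[i [j [iX jX eij m]]] mY; rewrite addSn.
apply/matchableS; exists i, j; split; rewrite ?inE ?iX ?jX //.
apply: matchable_mono (IHk _ _ m mY); last first.
  by apply: disjointWl dXY; apply: subset_trans (subsetDl _ _) (subsetDl _ _).
apply/subsetP=> v; rewrite !inE => /orP[/and3P[-> -> ->] //|vY].
by rewrite vY orbT andbT; apply/andP; split; apply: contraTneq vY => ->;
  rewrite (disjointFr dXY).
Qed.

Lemma matchable_edge i j : i != j -> e i j -> matchable 1 [set i; j].
Proof. by move=> ne eij; apply/matchableS; exists i, j; rewrite !inE !eqxx orbT. Qed.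

Lemma matchable_remove k c X : matchable k X -> matchable k.-1 (X :\ c).
Proof.
elim: k X => // k IHk X /matchableS[i [j [iX jX eij m]]] /=.
have [->|nic] := eqVneq c i; first by apply: matchable_mono m; exact: subsetDl.
have [->|njc] := eqVneq c j; first by apply: matchable_mono m; rewrite setSD ?subsetDl.
case: k IHk m => // k IHk m; apply/matchableS; exists i, j; split=> //.
- by rewrite !inE eq_sym nic.
- by rewrite !inE eq_sym njc.
- apply: matchable_mono (IHk _ m).
  by apply/subsetP=> v; rewrite !inE => /and4P[-> -> -> ->].
Qed.

(** A vertex meets at most one edge of a matching. *)
Lemma matchable_setD k X Z : matchable k X -> matchable (k - #|Z|) (X :\: Z).
Proof.
move: {2}#|Z| (erefl #|Z|) => z; elim: z k X Z => [|z IHz] k X Z Zz m.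
  by rewrite Zz subn0; move/eqP: Zz; rewrite cards_eq0 => /eqP ->; rewrite setD0.
have [c cZ] : exists c, c \in Z by apply/card_gt0P; rewrite Zz.
have Zc : #|Z :\ c| = z by move: Zz; rewrite (cardsD1 c) cZ => -[].
have := IHz _ _ _ Zc (matchable_remove c m); rewrite Zc Zz subnS -subn1 subnAC subn1.
rewrite (_ : X :\ c :\: _ = X :\: Z) //; apply/setP=> v; rewrite !inE.
by case: eqP => [->|] /=; rewrite ?cZ ?andbF.
Qed.

Hypothesis e_irr : irreflexive e.

Lemma edge_neq i j : e i j -> i != j.
Proof. by apply: contraTneq => ->; rewrite e_irr. Qed.

Lemma matchable_exact k X : matchable k X ->
  exists Y : {set T}, [/\ Y \subset X, #|Y| = (2 * k)%N & matchable k Y].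
Proof.
elim: k X => [|k IHk] X; first by exists set0; rewrite sub0set cards0.
move=> /matchableS[i [j [iX jX eij /IHk[Y [sY Yk m]]]]].
have ne := edge_neq eij.
have jY : j \notin Y by apply/negP=> /(subsetP sY); rewrite !inE eqxx.
have iY : i \notin j |: Y.
  by rewrite !inE negb_or ne; apply/negP=> /(subsetP sY); rewrite !inE eqxx andbF.
exists (i |: (j |: Y)); split.
- rewrite !subUset !sub1set iX jX /=; apply: subset_trans sY _.
  by apply: subset_trans (subsetDl _ _) (subsetDl _ _).
- by rewrite cardsU1 iY cardsU1 jY Yk; lia.
- apply/matchableS; exists i, j; rewrite !inE !eqxx orbT.
  by split=> //; rewrite setU1K // setU1K.
Qed.

Lemma matchable_card k X : matchable k X -> (2 * k <= #|X|)%N.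
Proof. by case/matchable_exact => Y [/subset_leq_card le <- _]. Qed.

Lemma matchable_bipartite k X Y : [disjoint X & Y] ->
  #|X| = k -> #|Y| = k -> {in X & Y, forall x y, e x y} ->
  matchable k (X :|: Y).
Proof.
elim: k X Y => // k IHk X Y dXY Xk Yk eXY.
have [x xX] : exists c, c \in X by apply/card_gt0P; rewrite Xk.
have [y yY] : exists c, c \in Y by apply/card_gt0P; rewrite Yk.
apply/matchableS; exists x, y; rewrite !inE xX yY orbT eXY //; split=> //.
apply: matchable_mono (IHk (X :\ x) (Y :\ y) _ _ _ _).
- apply/subsetP=> v; rewrite !inE => /orP[/andP[-> vX]|/andP[-> vY]].
    by rewrite vX andbT /=; apply: contraTneq vX => ->; rewrite (disjointFl dXY).
  by rewrite vY orbT andbT /=; apply: contraTneq vY => ->; rewrite (disjointFr dXY).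
- by apply: disjointWl (subsetDl _ _) _; apply: disjointWr dXY; exact: subsetDl.
- by move: Xk; rewrite (cardsD1 x) xX => -[].
- by move: Yk; rewrite (cardsD1 y) yY => -[].
- by move=> u v; rewrite !inE => /andP[_ uX] /andP[_ vY]; exact: eXY.
Qed.

Lemma matchable_matching M : matching e M -> matchable #|M| (cover M).
Proof.
move: {2}#|M| (erefl #|M|) => k; elim: k M => [|k IHk] M Mk /andP[sM tM].
  by rewrite Mk.
have [E EM] : exists E, E \in M by apply/card_gt0P; rewrite Mk.
have Mc : #|M :\ E| = k by move: Mk; rewrite (cardsD1 E) EM => -[].
have /imsetP[[i j] /= eij EE] := subsetP sM E EM.
have sE v : v \in E -> v \in cover M by move=> vE; apply/bigcupP; exists E.
rewrite Mk; apply/matchableS; exists i, j; split=> //.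
- by apply: sE; rewrite EE !inE eqxx.
- by apply: sE; rewrite EE !inE eqxx orbT.
have := IHk _ Mc _; rewrite Mc => H.
apply: matchable_mono (H _); last first.
  apply/andP; split; first by apply: subset_trans sM; exact: subsetDl.
  by apply: trivIsetS tM; exact: subsetDl.
apply/subsetP=> v /bigcupP[E']; rewrite !inE => /andP[neE E'M] vE'.
have nvE : v \notin E.
  by have /trivIsetP/(_ _ _ E'M EM neE)/disjointFr -> := tM.
move: nvE; rewrite EE !inE negb_or andbC => /andP[-> ->] /=.
by apply/bigcupP; exists E'.
Qed.

(** A maximum matching contains matchings of all smaller sizes. *)
Lemma matchable_setT k : (k <= matching_number e)%N -> matchable k [set: T].
Proof.
have M0 : matching e set0.
  by rewrite /matching sub0set; apply/trivIsetP=> A B; rewrite inE.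
rewrite /matching_number (bigmax_eq_arg _ M0) //.
case: arg_maxnP => // M mM _ leM.
have := matchable_matching mM; rewrite -(subnK leM).
elim: (#|M| - k)%N => [|d IHd]; first by apply: matchable_mono; exact: subsetT.
rewrite addSn => m; apply: IHd.
have /matchableS[i [j [_ _ _]]] := m.
by apply: matchable_mono; apply: subset_trans (subsetDl _ _) (subsetDl _ _).
Qed.

End Matchable.

(** * Squarefree powers of edge ideals *)

Section SquarefreePowers.
Variables (K : fieldType) (n : nat) (e : rel 'I_n).
Hypothesis e_irr : irreflexive e.
Local Notation S := {mpoly K[n]}.
Implicit Types (m : 'X_{1..n}) (p q : S) (X : {set 'I_n}).

Definition unmatchable k : {set {set 'I_n}} := [set X | ~~ matchable e k X].

Lemma down_closed_unmatchable k : down_closed (unmatchable k).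
Proof.
by move=> X Y sXY; rewrite !inE; apply: contra; exact: matchable_mono.
Qed.

(** The edges may repeat or overlap here, as in the monomials of an ordinary
    power; only squarefreeness of [m] makes them disjoint. *)
Fixpoint edges_divide k m : Prop :=
  if k is k'.+1 then
    exists i j m', [/\ e i j, m = (U_(i) + U_(j) + m')%MM & edges_divide k' m']
  else True.

Lemma edges_divideD k m m' : edges_divide k m -> edges_divide k (m + m').
Proof.
elim: k m => //= k IHk m [i [j [m1 [eij -> /IHk H]]]].
by exists i, j, (m1 + m')%MM; rewrite addmA.
Qed.

(** Two of the edges sharing a vertex would put its square into [m]. *)
Lemma edges_divide_matchable k m : squarefree_mnm m -> edges_divide k m ->
  matchable e k (mnm_supp m).
Proof.
elim: k m => // k IHk m sqf [i [j [m' [eij mE H]]]].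
have ne := edge_neq e_irr eij.
have mi v : m v = ((i == v) + (j == v) + m' v)%N by rewrite mE !mnmDE !mnm1E.
apply/matchableS; exists i, j; split=> //.
- by rewrite inE mi eqxx.
- by rewrite inE mi eqxx addn1.
apply: matchable_mono (IHk m' _ H).
- apply/subsetP=> v; rewrite !inE mi => m'v; have := sqf v; rewrite mi.
  rewrite (eq_sym v i) (eq_sym v j).
  by case: eqP => _; case: eqP => _ //=; lia.
- by move=> v; have := sqf v; rewrite mi; lia.
Qed.

Lemma edge_ideal_pow_edges k p : ideal_pow (edge_ideal K e) k p ->
  forall m, m \in msupp p -> edges_divide k m.
Proof.
have idQ l : is_ideal (fun p => forall m, m \in msupp p -> edges_divide l m).
  split=> [m|a b Ha Hb m|a b Hb m]; first by rewrite msupp0.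
  - by move/msuppD_le; rewrite mem_cat => /orP[/Ha|/Hb].
  - case/msuppM_le/allpairsP=> -[m1 m2] /= [_ /Hb H ->].
    by rewrite addmC; exact: edges_divideD.
have Q1 q : edge_ideal K e q -> forall m, m \in msupp q -> edges_divide 1 m.
  apply: (ideal_gen_min (idQ 1%N)) => _ [i [j [eij ->]]] m.
  rewrite -mpolyXD => /mem_msuppXP <-; exists i, j, 0%MM.
  by rewrite addm0.
apply: (ideal_gen_min (idQ k)) => _ [s [Hs ->]].
rewrite -[in edges_divide _](size_tuple s).
have {Hs} : forall q, q \in tval s -> edge_ideal K e q by [].
elim: (tval s) => // q t IHt Ht m.
rewrite big_cons => /msuppM_le/allpairsP=> -[[m1 m2] /= [H1 H2 ->]].
have [i [j [m' [eij -> _]]]] := Q1 q (Ht q (mem_head _ _)) m1 H1.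
exists i, j, (m2 + m')%MM; split=> //; first by rewrite -addmA (addmC m').
apply/edges_divideD/IHt => // r rt; by apply: Ht; rewrite inE rt orbT.
Qed.

Lemma matchable_ideal_pow k X : matchable e k X ->
  ideal_pow (edge_ideal K e) k 'X_[mesym1 X].
Proof.
move=> mX; have [s [r [Hs ->]]] : exists (s : k.-tuple S) r,
    (forall q, q \in s -> edge_ideal K e q) /\
    'X_[mesym1 X] = r * \prod_(q <- s) q.
  elim: k X mX => [|k IHk] X.
    by exists [tuple], 'X_[mesym1 X]; rewrite big_nil mulr1.
  case/matchableS=> i [j [iX jX eij /IHk[s [r [Hs Er]]]]].
  exists [tuple of 'X_i * 'X_j :: s], r; split.
    move=> q; rewrite inE => /predU1P[->|/Hs //].
    by apply: mem_ideal_gen; exists i, j.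
  rewrite big_cons mulrCA -Er -!mpolyXD; congr 'X_[_]; apply/mnmP=> v.
  rewrite !mnmDE !mnm1E !mnmE !inE (eq_sym i) (eq_sym j).
  case: (v =P i) => [->|_]; first by rewrite iX (negbTE (edge_neq e_irr eij)).
  by case: (v =P j) => [->|_]; rewrite ?jX.
apply: (ideal_mull (ideal_gen_ideal _)); apply: mem_ideal_gen; by exists s.
Qed.

(** If the support of a monomial contains a [k]-matching, then the squarefree
    monomial of that support divides it and is a multiple of a product of [k]
    edges. *)
Lemma squarefree_pow_edge_ideal k :
  squarefree_pow (edge_ideal K e) k = SR (unmatchable k).
Proof.
apply: functional_extensionality => p; apply: propositional_extensionality.
have idD := SR_ideal K (@down_closed_unmatchable k).
split; first (apply: (ideal_gen_min idD) => {}p).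
  move=> [m [-> sqf /edge_ideal_pow_edges H]] m' m'D; rewrite mcoeffX.
  case: eqP => // E; move: m'D; rewrite -E inE edges_divide_matchable //.
  by apply: H; rewrite msuppX inE.
move=> Hp; rewrite [p]mpolyE big_seq.
apply: (ideal_sum (ideal_gen_ideal _)) => m mp.
rewrite -mul_mpolyC; apply: (ideal_mull (ideal_gen_ideal _)).
have mX : matchable e k (mnm_supp m).
  apply: contraLR mp => N; rewrite mcoeff_msupp negbK.
  by apply/eqP/Hp; rewrite inE.
have le : (mesym1 (mnm_supp m) <= m)%MM by rewrite mesym1_le.
rewrite -(submK le) mpolyXD; apply: (ideal_mull (ideal_gen_ideal _)).
apply: mem_ideal_gen; exists (mesym1 (mnm_supp m)); split=> //.
- by move=> i; rewrite mnmE leq_b1.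
- exact: matchable_ideal_pow.
Qed.

(** The squarefree monomial on the vertices of a [k]-matching is a generator of
    least degree. *)
Lemma indeg_squarefree_pow k : matchable e k setT ->
  indeg (squarefree_pow (edge_ideal K e) k) = (2 * k)%N.
Proof.
move=> /(matchable_exact e_irr)[Y [_ Yk mY]].
have card_supp m : (#|mnm_supp m| <= mdeg m)%N.
  rewrite mdegE -sum1_card [X in (_ <= X)%N](bigID (mem (mnm_supp m))) /=.
  apply: leq_trans (leq_addr _ _); apply: leq_sum => i; by rewrite inE.
have genP m : (SR (unmatchable k) : S -> Prop) 'X_[m] -> matchable e k (mnm_supp m).
  move=> H; apply/negPn/negP => N; have := H m; rewrite inE N => /(_ isT)/eqP.
  by rewrite mcoeffX eqxx oner_eq0.
apply: min_natE; rewrite squarefree_pow_edge_ideal; split; last first.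
  move=> _ [m [[/genP /(matchable_card e_irr) le _] <-]].
  exact: leq_trans le (card_supp m).
exists (mesym1 Y); rewrite mdeg_mesym1; split=> //; split.
  by apply/SR_monomial; rewrite inE negbK.
move=> m /genP /(matchable_card e_irr) le /mnm_lepP leY.
have /eqP sY : mnm_supp m == Y.
  rewrite eqEcard Yk le andbT; apply/subsetP=> i; rewrite inE => mi.
  by have := leq_trans mi (leY i); rewrite mnmE lt0b.
apply/mnmP=> i; apply/eqP; rewrite eqn_leq leY mnmE -sY inE.
by case: (m i).
Qed.

End SquarefreePowers.

(** * Chordal graphs *)

Section Chordal.
Variables (T : finType) (h : rel T).
Hypotheses (h_sym : ssrbool.symmetric h) (h_irr : irreflexive h).
Implicit Types (A U W X Y : {set T}) (s p : seq T) (u v w x y z : T).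

Definition induced_path s : Prop := uniq s /\
  forall x0 i j, (i < j < size s)%N -> h (nth x0 s i) (nth x0 s j) = (j == i.+1).

Lemma induced_path_drop k s : induced_path s -> induced_path (drop k s).
Proof.
move=> [us Hs]; split; first exact: drop_uniq.
move=> x0 i j /andP[lt_ij]; rewrite size_drop => lt_j.
by rewrite !nth_drop Hs ?addnS ?eqn_add2l //; lia.
Qed.

Lemma induced_path_cons z s : induced_path s -> z \notin s ->
  (forall x0 i, (i < size s)%N -> h z (nth x0 s i) = (i == 0%N)) ->
  induced_path (z :: s).
Proof.
move=> [us Hs] zs Hz; split; first by rewrite /= zs.
move=> x0 [|i] [|j] //=; first by rewrite ltnS => lt_j; rewrite Hz.
by rewrite !ltnS => lt_ij; rewrite Hs.
Qed.

(** Short-cutting a walk at the last neighbour of its starting point. *)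
Lemma induced_path_exists z p : path h z p -> exists s,
  [/\ induced_path s, {subset s <= z :: p}, s != [::],
      forall x0, head x0 s = z & forall x0, last x0 s = last z p].
Proof.
elim: p z => [|a p IHp] z /=.
  move=> _; exists [:: z]; split=> //; split=> // x0 i j.
  by rewrite /= ltnS leqn0 => /andP[lt_ij /eqP j0]; rewrite j0 in lt_ij.
case/andP=> hza /IHp[s [is_s sub_s s0 hd_s last_s]].
have last_drop k x0 : (k < size s)%N -> last x0 (drop k s) = last a p.
  move=> lt_k; rewrite -(last_s x0) -{2}(cat_take_drop k s) last_cat.
  have : drop k s != [::] by rewrite -size_eq0 size_drop subn_eq0 -ltnNge.
  by case: (drop k s).
have [zs|zs] := boolP (z \in s).
  have lt_k : (index z s < size s)%N by rewrite index_mem.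
  exists (drop (index z s) s); split.
  - exact: induced_path_drop.
  - by move=> v /mem_drop /sub_s; rewrite [in X in _ -> X]inE => ->; rewrite orbT.
  - by rewrite -size_eq0 size_drop subn_eq0 -ltnNge.
  - by move=> x0; rewrite -nth0 nth_drop addn0 nth_index.
  - by move=> x0; exact: last_drop.
have exk : exists k, (k < size s)%N && h z (nth z s k).
  exists 0%N; rewrite nth0 hd_s hza andbT lt0n.
  by case: (s) s0.
have ubk k : (k < size s)%N && h z (nth z s k) -> (k <= size s)%N.
  by case/andP=> /ltnW.
case: (ex_maxnP exk ubk) => k /andP[lt_k hzk] maxk.
exists (z :: drop k s); split=> //.
- apply: induced_path_cons; first exact: induced_path_drop.
    by apply: contra zs; exact: mem_drop.
  move=> x0 i; rewrite size_drop => lt_i; rewrite nth_drop.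
  rewrite (set_nth_default z) ?[(k + i < _)%N]ltnNge; last by lia.
  case: i lt_i => [|i] lt_i; first by rewrite addn0.
  apply/negbTE/negP => hzi; have := maxk (k + i.+1)%N; rewrite hzi andbT.
  have -> : (k + i.+1 < size s)%N by lia.
  by move=> /(_ isT); lia.
- move=> v; rewrite inE => /predU1P[->|/mem_drop/sub_s vs]; first exact: mem_head.
  by rewrite inE vs orbT.
- by move=> x0 /=; rewrite last_drop.
Qed.

Lemma induced_cycleI c :
  uniq c -> (forall x0 i j, (i < size c)%N -> (j < size c)%N ->
    h (nth x0 c i) (nth x0 c j) =
    ((i.+1 %% size c)%N == j) || ((j.+1 %% size c)%N == i)) ->
  induced_cycle h c.
Proof.
move=> uc Hc; split=> //.
have nextE x i : (i < size c)%N ->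
    next c (nth x c i) = nth x c (i.+1 %% size c)%N.
  move=> lt_i; rewrite next_nth mem_nth // index_uniq //.
  case: c uc lt_i {Hc} => // a c uc; rewrite /= ltnS leq_eqVlt => /predU1P[->|lt_i].
    by rewrite modnn nth_default.
  by rewrite modn_small ?ltnS //=; exact: set_nth_default.
move=> x y xc yc.
suff H i j : (i < size c)%N -> (j < size c)%N ->
    h (nth x c i) (nth x c j) =
    (next c (nth x c i) == nth x c j) || (next c (nth x c j) == nth x c i).
  have := H (index x c) (index y c); rewrite !nth_index //.
  by apply; rewrite index_mem.
move=> lt_i lt_j; have c0 : (0 < size c)%N by case: (c) xc.
by rewrite Hc // !nextE // !nth_uniq ?ltn_pmod.
Qed.

Definition clique A : bool := [forall x in A, forall y in A, (x != y) ==> h x y].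

Lemma cliqueP A : reflect {in A &, forall x y, x != y -> h x y} (clique A).
Proof.
apply: (iffP forall_inP) => [H x y xA yA|H x xA].
  by move/forall_inP/(_ y yA)/implyP: (H x xA).
by apply/forall_inP=> y yA; apply/implyP; exact: H.
Qed.

Definition simplicial W v : Prop :=
  v \in W /\ {in W &, forall x y, h v x -> h v y -> x != y -> h x y}.

Definition separable W : Prop := exists A : {set T},
  [/\ A \proper W, A != set0 & forall x y, x \in A -> y \in W :\: A -> ~~ h x y].

Lemma connected_onP W : connected_on h W <-> ~ separable W.
Proof.
split=> [conW [A [/properP[sA [y yW yA]] /set0Pn[x xA] sepA]]|nsep x y xW yW].
  have /connectP[p] := conW x y (subsetP sA x xA) yW.
  elim: p x xA => [|z p IHp] x xA /=; first by move=> _ yx; rewrite yx xA in yA.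
  case/andP=> /and3P[_ zW hxz] pp lp; apply: IHp pp lp.
  by apply: contraLR hxz => zA; apply: sepA; rewrite // inE zA.
apply/negPn/negP=> ncon; apply: nsep.
exists [set z in W | connect (induced_graph h W) x z]; split.
- apply/properP; split; first by apply/subsetP=> z; rewrite inE => /andP[].
  by exists y; rewrite // inE yW.
- by apply/set0Pn; exists x; rewrite inE xW connect0.
- move=> u v; rewrite !inE => /andP[uW cu] /andP[]; rewrite negb_and => + vW.
  rewrite vW /=; apply: contra => huv; apply: connect_trans cu _.
  by apply: connect1; rewrite /induced_graph /= uW vW.
Qed.

Lemma connected_on_cons X x z : connected_on h X ->
  x \in X -> h x z -> connected_on h (z |: X).
Proof.
move=> conX xX hxz; rewrite /connected_on; set g := induced_graph h _.
have gC : connect_sym g.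
  by apply: sym_connect_sym => u v; rewrite /g /induced_graph /= h_sym andbCA.
have toX u : u \in z |: X -> connect g x u.
  rewrite !inE => /predU1P[->|uX].
    by apply: connect1; rewrite /g /induced_graph /= !inE xX eqxx orbT.
  apply: connect_sub (conX x u xX uX) => a b /and3P[aX bX hab].
  by apply: connect1; rewrite /g /induced_graph /= !inE aX bX hab !orbT.
by move=> u v uX vX; apply: connect_trans (toX v vX); rewrite gC toX.
Qed.

(** Otherwise a shortest path through the connected set [X] from [z] to [z'],
    closed up through [y], would be a long cycle without chords. *)
Lemma chordal_common_neighbors X y z z' : chordal h ->
  connected_on h X -> y \notin X -> {in X, forall x, ~~ h x y} ->
  h z y -> h z' y -> z \notin X -> z' \notin X ->
  (exists2 x, x \in X & h x z) -> (exists2 x, x \in X & h x z') ->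
  z != z' -> h z z'.
Proof.
move=> cho conX yX Xy hzy hz'y zX z'X [x xX hxz] [x' x'X hx'z'] ne.
apply/negPn/negP => nzz'.
have /connectP[p pp x'E] := conX x x' xX x'X.
have pX : {subset p <= X}.
  elim: p x {xX hxz x'E} pp => // a p IHp x /= /andP[/and3P[_ aX _] pp] v.
  by rewrite inE => /predU1P[->//|]; exact: IHp pp v.
have pwalk : path h z (x :: rcons p z').
  rewrite /= h_sym hxz rcons_path -x'E hx'z' andbT.
  by apply: sub_path pp => u v /and3P[].
have [s [[us is_s] sub_s s0 hd_s last_s]] := induced_path_exists pwalk.
rewrite /= last_rcons in last_s.
have s_in v : v \in s -> [|| v == z, v == z' | v \in X].
  move/sub_s; rewrite !inE mem_rcons inE => /or4P[->|/eqP->|->|/pX->];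
  by rewrite ?xX ?orbT.
have size0 : (0 < size s)%N by rewrite lt0n size_eq0.
have nth_last_s : nth y s (size s).-1 = z' by rewrite nth_last last_s.
have nth0_s : nth y s 0 = z by rewrite nth0 hd_s.
have size3 : (2 < size s)%N.
  rewrite ltnNge; apply/negP => le2.
  have [sE|sE] : (size s = 1 \/ size s = 2)%N.
  - by case: (size s) size0 le2 => [|[|[|]]] // _ _; [left | right].
  - by move: ne; rewrite -nth_last_s sE nth0_s eqxx.
  - have nth1_s : nth y s 1 = z' by rewrite -nth_last_s sE.
    by have := is_s y 0%N 1%N; rewrite sE nth0_s nth1_s (negbTE nzz') => /(_ isT).
have hy i : (i < size s)%N -> h y (nth y s i) = (i == 0%N) || (i == (size s).-1).
  move=> lt_i; case: (i =P 0%N) => [->|/eqP i0]; first by rewrite nth0_s h_sym.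
  case: (i =P (size s).-1) => [->|/eqP iN]; first by rewrite nth_last_s h_sym.
  have /or3P[zi|zi|] := s_in _ (mem_nth y lt_i).
  - by rewrite -nth0_s nth_uniq // (negbTE i0) in zi.
  - by rewrite -nth_last_s nth_uniq ?prednK // (negbTE iN) in zi.
  - by move/Xy; rewrite h_sym => /negbTE.
have ys : y \notin s.
  apply/negP => /s_in /or3P[/eqP yz|/eqP yz|]; last exact/negP.
  - by rewrite yz h_irr in hzy.
  - by rewrite yz h_irr in hz'y.
have hs i j : (i < size s)%N -> (j < size s)%N ->
    h (nth y s i) (nth y s j) = (j == i.+1) || (i == j.+1).
  move=> lt_i lt_j; have [lt|lt|->] := ltngtP i j.
  - by rewrite is_s ?lt // (ltn_eqF (leqW lt)) orbF.
  - by rewrite h_sym is_s ?lt // (ltn_eqF (leqW lt)).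
  - by rewrite h_irr ltn_eqF.
have modE k M : (k <= M)%N -> (k %% M = if k == M then 0 else k)%N.
  by rewrite leq_eqVlt; case: eqP => [->|_ /= ltk]; rewrite ?modnn ?modn_small.
(* In the cycle [y :: s] the vertex [y] has index 0, and [modE] is the wrap-around
   from the last index. *)
have : induced_cycle h (y :: s).
  apply: induced_cycleI; first by rewrite /= ys.
  move=> x0 i j lt_i lt_j; rewrite !(set_nth_default y x0) //.
  rewrite !modE //; case: i lt_i => [|i]; case: j lt_j => [|j] /=;
    rewrite !ltnS => lt_j lt_i.
  - by rewrite h_irr; move: size3; clear; case: (size s).
  - rewrite hy //; move: lt_j size3; clear; do 2!case: ifP; lia.
  - rewrite h_sym hy //; move: lt_i size3; clear; do 2!case: ifP; lia.
  - rewrite hs //; move: lt_i lt_j size3; clear; do 2!case: ifP; lia.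
by move/cho; rewrite /= ltnNge size3.
Qed.

(** Let [X] be a largest connected set with a nonempty set [Y] of vertices that
    are neither in [X] nor adjacent to it.  By maximality the boundary of [X]
    is completely joined to [Y], and it is a clique by the previous lemma, so a
    simplicial vertex of [Y] is simplicial in the whole graph. *)
Lemma simplicial_exists W : chordal h -> W != set0 -> exists v, simplicial W v.
Proof.
move=> cho; move: {2}#|W| (leqnn #|W|) => k; elim: k W => [|k IHk] W.
  by rewrite leqn0 cards_eq0 => ->.
move=> Wk W0.
pose far X y := (y \notin X) && [forall x in X, ~~ h x y].
pose P X := [&& X \subset W, X != set0,
  [forall x in X, forall y in X, connect (induced_graph h X) x y] &
  [exists y in W, far X y]].
have [clW|] := boolP (clique W).
  have /set0Pn[v vW] := W0; exists v; split=> // x y xW yW _ _.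
  exact: (cliqueP _ clW).
case/forall_inPn => x0 x0W /forall_inPn[y0 y0W]; rewrite negb_imply => /andP[ne0 nh0].
have P0 : P [set x0].
  apply/and4P; split; first by rewrite sub1set.
  - by apply/set0Pn; exists x0; rewrite inE.
  - apply/forall_inP=> x /set1P ->; apply/forall_inP=> y /set1P ->.
    exact: connect0.
  - apply/exists_inP; exists y0 => //; apply/andP; split.
      by rewrite inE eq_sym.
    by apply/forall_inP=> x /set1P ->.
case: (arg_maxnP (fun X => #|X|) P0) => X /and4P[sXW X0 /forall_inP conX' farX] maxX.
have conX : connected_on h X.
  by move=> x y xX yX; exact: (forall_inP (conX' x xX)).
pose Y := [set y in W | far X y].
have Y0 : Y != set0.
  by case/exists_inP: farX => y yW fy; apply/set0Pn; exists y; rewrite inE yW.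
have sY : Y \subset W by apply/subsetP=> y; rewrite inE => /andP[].
have Yk : (#|Y| <= k)%N.
  rewrite -ltnS; apply: leq_trans Wk; apply: proper_card; apply/properP; split=> //.
  case/set0Pn: X0 => x xX; exists x; first exact: (subsetP sXW).
  by rewrite inE /far xX andbF.
have boundary z : z \in W -> z \notin X -> z \notin Y -> exists2 x, x \in X & h x z.
  move=> zW zX; rewrite inE zW /far zX /= => /forall_inPn[x xX /negPn hxz].
  by exists x.
have join z y : z \in W -> z \notin X -> z \notin Y -> y \in Y -> h z y.
  move=> zW zX zY yY; have [x xX hxz] := boundary z zW zX zY.
  apply/negPn/negP => nzy.
  suff /maxX : P (z |: X) by rewrite /= cardsU1 zX ltnn.
  move: (yY); rewrite inE => /and3P[yW yX /forall_inP nXy].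
  apply/and4P; split.
  - by rewrite subUset sub1set zW.
  - by apply/set0Pn; exists z; rewrite setU11.
  - have con := connected_on_cons conX xX hxz.
    by apply/forall_inP=> u uX; apply/forall_inP=> v vX; exact: con.
  - apply/exists_inP; exists y => //; apply/andP; split.
      by rewrite !inE negb_or yX andbT; apply: contraNneq zY => <-.
    by apply/forall_inP=> u /setU1P[->//|]; exact: nXy.
have [v [vY simpv]] := IHk Y Yk Y0.
move: (vY); rewrite inE => /and3P[vW vX /forall_inP nXv].
have nbrX x : h v x -> x \notin X by apply: contraTN => /nXv; rewrite h_sym.
exists v; split=> // x y xW yW hvx hvy ne.
have [xY|xY] := boolP (x \in Y); have [yY|yY] := boolP (y \in Y).
- exact: simpv.
- by rewrite h_sym join ?nbrX.
- by rewrite join ?nbrX.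
- apply: (chordal_common_neighbors cho conX vX nXv); rewrite ?nbrX //.
  + by rewrite h_sym.
  + by rewrite h_sym.
  + by apply: boundary; rewrite ?nbrX.
  + by apply: boundary; rewrite ?nbrX.
Qed.

End Chordal.

(** * Depth of the clique complex of a chordal graph *)

Section CliqueComplex.
Variables (K : fieldType) (n : nat) (h : rel 'I_n).
Hypotheses (h_sym : ssrbool.symmetric h) (h_irr : irreflexive h).
Hypothesis h_chordal : chordal h.
Local Notation S := {mpoly K[n]}.
Implicit Types (A U W : {set 'I_n}) (v : 'I_n).

Definition highly_connected c W : Prop :=
  (c < #|W|)%N /\ forall U, (#|U| < c)%N -> ~ separable h (W :\: U).

Definition clique_complex W : {set {set 'I_n}} :=
  [set A : {set 'I_n} | (A \subset W) && clique h A].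

Lemma clique_sub A (B : {set 'I_n}) : A \subset B -> clique h B -> clique h A.
Proof.
move=> sAB /cliqueP clB; apply/cliqueP => x y xA yA.
by apply: clB; exact: (subsetP sAB).
Qed.

Lemma down_closed_clique_complex W : down_closed (clique_complex W).
Proof.
move=> A B sAB; rewrite !inE => /andP[sB clB].
by rewrite (subset_trans sAB sB) (clique_sub sAB clB).
Qed.

(** Otherwise the neighbours of [v] would form a separating set with fewer than
    [c] elements. *)
Lemma simplicial_degree c W v : highly_connected c W -> simplicial h W v ->
  (c <= #|[set u in W | h v u]|)%N.
Proof.
move=> [cW conn] [vW _]; set U := [set u in W | h v u].
rewrite leqNgt; apply/negP => lt_c; apply: (conn U lt_c).
have vU : v \notin U by rewrite inE h_irr andbF.
exists [set v]; split; last 2 first.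
- by apply/set0Pn; exists v; rewrite inE.
- move=> x y /set1P -> ; rewrite !inE => /and3P[_ + yW].
  by rewrite yW.
rewrite properEcard sub1set inE vU vW cards1 /=.
have sU : U \subset W by apply/subsetP=> u; rewrite inE => /andP[].
rewrite cardsD (setIidPr sU) ltn_subRL addn1.
exact: leq_ltn_trans lt_c cW.
Qed.

(** The neighbours of [v] are pairwise adjacent, so they all lie on the same
    side of any separation of [W :\ v], and [v] can be added to that side. *)
Lemma highly_connected_remove c W v : simplicial h W v ->
  (c.+1 < #|W|)%N -> highly_connected c W -> highly_connected c (W :\ v).
Proof.
move=> [vW simp] lt_c [_ conn]; split.
  by move: lt_c; rewrite (cardsD1 v) vW.
move=> U Uc [A [sA A0 sepA]]; apply: (conn U Uc).
have /properP[sAW [w wW wA]] := sA.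
have vA : v \notin A by apply/negP => /(subsetP sAW); rewrite !inE eqxx andbF.
have sAWU : A \subset W :\: U.
  by apply: subset_trans sAW _; rewrite setSD // subsetDl.
have wWU : w \in W :\: U by apply: subsetP wW; rewrite setSD // subsetDl.
have inW x : x \in A -> x \in W by move/(subsetP sAWU); rewrite inE => /andP[].
have [/existsP[a /andP[aA hva]]|nva] := boolP [exists a, (a \in A) && h v a];
  last first.
  exists A; split=> //; first by apply/properP; split=> //; exists w.
  move=> x y xA; rewrite !inE => /and3P[yA yU yW].
  have [->|nyv] := eqVneq y v; last by apply: sepA; rewrite // !inE yA yU nyv.
  apply: contra nva => hxv; apply/existsP; exists x.
  by rewrite xA h_sym.
have [vU|vU] := boolP (v \in U).
  exists A; split=> //; first by apply/properP; split=> //; exists w.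
  move=> x y xA; rewrite !inE => /and3P[yA yU yW]; apply: sepA => //.
  by rewrite !inE yA yU yW andbT; apply: contraNneq yU => ->.
exists (v |: A); split.
- apply/properP; split; first by rewrite subUset sub1set !inE vU vW.
  exists w => //; rewrite !inE negb_or wA andbT.
  by move: wW; rewrite !inE => /and3P[].
- by apply/set0Pn; exists v; rewrite setU11.
- move=> x y /setU1P xv; rewrite !inE negb_or => /and3P[/andP[yv yA] yU yW].
  have yN : y \in W :\ v :\: U :\: A by rewrite !inE yA yU yv.
  case: xv => [->|xA]; last exact: sepA.
  apply: contraTN (sepA a y aA yN) => hvy; rewrite negbK.
  by apply: simp => //; [exact: inW | apply: contraNneq yA => <-].
Qed.

(** Removing a simplicial vertex [v]: the link of [v] in the clique complex is
    the simplex on its at least [c] neighbours.  When only [c + 1] vertices are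
    left, they form a clique. *)
Lemma weakly_regular_clique_complex c W : highly_connected c W ->
  weakly_regular (SR (clique_complex W) : S -> Prop) (esyms K n c.+1).
Proof.
move: {2}#|W| (erefl #|W|) => k; elim: k W => [|k IHk] W Wk conW.
  by case: conW; rewrite Wk.
have W0 : W != set0 by rewrite -cards_eq0 Wk.
have [v simpv] := simplicial_exists h_sym h_irr h_chordal W0.
have [vW simp] := simpv; have deg := simplicial_degree conW simpv.
set N := [set u in W | h v u] in deg.
have vN : v \notin N by rewrite inE h_irr andbF.
have clN : clique h (v |: N).
  apply/cliqueP => x y; rewrite !inE.
  case/predU1P=> [->|/andP[xW hvx]] /predU1P[->|/andP[yW hvy]] //.
  - by rewrite eqxx.
  - by rewrite h_sym.
  - exact: simp.
have sNW : v |: N \subset W.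
  by rewrite subUset sub1set vW; apply/subsetP=> u; rewrite inE => /andP[].
have regN : weakly_regular (SR (powerset (v |: N)) : S -> Prop) (esyms K n c.+1).
  apply: weakly_regular_esyms_le (weakly_regular_simplex _ _).
  by rewrite cardsU1 vN.
have [lt_c|le_c] := ltnP c.+1 #|W|; last first.
  suff -> : clique_complex W = powerset (v |: N) by [].
  have E : v |: N = W.
    by apply/eqP; rewrite eqEcard sNW cardsU1 vN; exact: leq_trans le_c _.
  apply/setP=> A; rewrite !inE -{1}E; apply: andb_idr => sA.
  exact: clique_sub sA clN.
apply: (weakly_regular_link_deletion (v := v)).
- exact: down_closed_clique_complex.
- suff -> : [set A | v |: A \in clique_complex W] = powerset (v |: N) by [].
  apply/setP=> A; rewrite !inE subUset sub1set vW /=.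
  apply/andP/idP => [[sA /cliqueP cl]|sA].
    apply/subsetP=> u uA; rewrite !inE; case: eqVneq => //= ne.
    by rewrite (subsetP sA) // cl ?setU11 ?inE ?uA ?orbT // eq_sym.
  split; first exact: subset_trans sA sNW.
  by apply: clique_sub clN; rewrite subUset sub1set setU11.
- suff -> : [set A in clique_complex W | v \notin A] = clique_complex (W :\ v).
    apply: IHk; last exact: highly_connected_remove.
    by move: Wk; rewrite (cardsD1 v) vW => -[].
  by apply/setP=> A; rewrite !inE subsetD1 andbAC.
Qed.

End CliqueComplex.

(** * Matchings in the complement of a graph with a cut vertex *)

Lemma subset_of_card (T : finType) (A : {set T}) k : (k <= #|A|)%N ->
  exists2 B : {set T}, B \subset A & #|B| = k.
Proof.
elim: k => [|k IHk] le_k; first by exists set0; rewrite ?sub0set ?cards0.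
have [B sBA Bk] := IHk (ltnW le_k).
have : (0 < #|A :\: B|)%N by rewrite cardsD (setIidPr sBA) subn_gt0 Bk.
case/card_gt0P=> x; rewrite inE => /andP[xB xA]; exists (x |: B).
  by rewrite subUset sub1set xA.
by rewrite cardsU1 xB Bk.
Qed.

Section CutVertexMatchings.
Variables (T : finType) (e : rel T).
Hypotheses (e_sym : ssrbool.symmetric e) (e_irr : irreflexive e).
Implicit Types (A B F X Y : {set T}) (a b v : T).

(** Such an [F] has a disconnected link in the complex of vertex sets without a
    [k]-matching: no face of the link meets both [X] and its complement. *)
Definition separating_face k F : Prop := exists X : {set T},
  [/\ [disjoint X & F], exists a, a \in X, exists b, b \notin F :|: X &
      forall a b, a \in X -> b \notin F :|: X -> matchable e k (a |: (b |: F))].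

Section Split.
Variables (v : T) (A B : {set T}).
Hypotheses (AB_v : A :|: B = [set~ v]) (dAB : [disjoint A & B]).
Hypothesis AB_edges : {in A & B, forall a b, e a b}.

Let vA : v \notin A.
Proof. by apply/negP=> vA; have := in_setU v A B; rewrite AB_v !inE eqxx vA. Qed.

Let vB : v \notin B.
Proof. by apply/negP=> vB; have := in_setU v A B; rewrite AB_v !inE eqxx vB orbT. Qed.

Let ABv x : x != v -> (x \in A) || (x \in B).
Proof. by move=> ne; rewrite -in_setU AB_v !inE. Qed.

(** Balanced case: [F] consists of [k - 1] vertices of [A] and as many of [B],
    among them a neighbour of [v]. *)
Lemma separating_face_balanced k a0 : (1 < k)%N -> (k <= #|A|)%N ->
  (k <= #|B|)%N -> a0 \in A -> e v a0 ->
  exists2 F : {set T}, #|F| = (2 * k.-1)%N & separating_face k F.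
Proof.
case: k => [|[|k]] // _ kA kB a0A eva0.
have [P [sP a0P Pk]] : exists P : {set T}, [/\ P \subset A, a0 \in P & #|P| = k.+1].
  have [P sP Pk] : exists2 P : {set T}, P \subset A :\ a0 & #|P| = k.
    by apply: subset_of_card; move: kA; rewrite (cardsD1 a0) a0A ltnS; exact: ltnW.
  exists (a0 |: P); rewrite setU11 cardsU1 Pk; split=> //.
    by rewrite subUset sub1set a0A; apply: subset_trans sP (subsetDl _ _).
  by have -> // : a0 \notin P; apply/negP => /(subsetP sP); rewrite !inE eqxx.
have P0k : #|P :\ a0| = k by move: Pk; rewrite (cardsD1 a0) a0P => -[].
have sP0 : P :\ a0 \subset P by exact: subsetDl.
have [Q sQ Qk] := subset_of_card (ltnW kB).
have dPQ : [disjoint P & Q] by apply: disjointWl sP _; apply: disjointWr dAB.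
exists (P :|: Q).
  by rewrite cardsU (disjoint_setI0 dPQ) cards0 Pk Qk subn0 mul2n addnn.
have inA x : x \in A -> x \notin B by move=> xA; rewrite (disjointFr dAB).
have PB x : x \in P -> x \notin B by move/(subsetP sP)/inA.
have QA x : x \in Q -> x \notin A by move/(subsetP sQ) => xB; rewrite (disjointFl dAB).
exists (A :\: P); split.
- rewrite disjoints_subset; apply/subsetP=> x; rewrite !inE => /andP[xP xA].
  by rewrite negb_or xP; apply: contraL xA; exact: QA.
- have : (0 < #|A :\: P|)%N by rewrite cardsD (setIidPr sP) subn_gt0 Pk.
  by case/card_gt0P=> a; exists a.
- exists v; rewrite !inE (negbTE vA) andbF orbF negb_or.
  by rewrite (contra (subsetP sP v) vA) (contra (subsetP sQ v) vB).
move=> a b; rewrite !inE => /andP[aP aA].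
rewrite !negb_or negb_and negbK => /andP[/andP[bP bQ]].
rewrite (negbTE bP) /= => bA.
have aQ : a \notin Q by apply: contraL aA; exact: QA.
have [bv|bv] := eqVneq b v.
  have m1 := matchable_edge (edge_neq e_irr eva0) eva0.
  have aP0 : a \notin P :\ a0 by apply: contra aP; exact: (subsetP sP0).
  have m2 : matchable e k.+1 ((a |: P :\ a0) :|: Q).
    have sXA : a |: P :\ a0 \subset A.
      by rewrite subUset sub1set aA; exact: subset_trans sP0 sP.
    apply: matchable_bipartite => //.
    - by apply: disjointWl sXA _; apply: disjointWr dAB.
    - by rewrite cardsU1 P0k aP0.
    - by move=> x y /(subsetP sXA) xA /(subsetP sQ); exact: AB_edges.
  rewrite bv in bP bQ *; apply: matchable_mono (matchable_union _ m1 m2).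
    apply/subsetP=> x; rewrite !in_setU !in_set1 in_setD1.
    case/orP=> [/orP[/eqP->|/eqP->]|/orP[/orP[->|/andP[_ ->]]|->]];
    by rewrite ?a0P ?eqxx ?orbT.
  rewrite disjoints_subset; apply/subsetP=> x; rewrite in_setC !in_setU !in_set1.
  rewrite in_setD1 !negb_or negb_and => /orP[]/eqP->.
  - by rewrite bP bQ orbT !andbT; apply: contraNneq vA => ->.
  - rewrite eqxx /=; apply/andP; split; last by apply: contraL a0A; exact: QA.
    by rewrite andbT; apply: contraNneq aP => <-.
have bB : b \in B by have := ABv bv; rewrite (negbTE bA).
have m2 : matchable e k.+2 ((a |: P) :|: (b |: Q)).
  have sXA : a |: P \subset A by rewrite subUset sub1set aA.
  have sYB : b |: Q \subset B by rewrite subUset sub1set bB.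
  apply: matchable_bipartite => //.
  - by apply: disjointWl sXA _; apply: disjointWr dAB.
  - by rewrite cardsU1 aP Pk.
  - by rewrite cardsU1 bQ Qk.
  - by move=> x y /(subsetP sXA) xA /(subsetP sYB); exact: AB_edges.
apply: matchable_mono m2.
by apply/subsetP=> x; rewrite !inE => /orP[/orP[]|/orP[]] ->; rewrite ?orbT.
Qed.

(** Unbalanced case: [F] contains all of [A] but one vertex [a0], together with
    a matching [Y] of size [k - #|A|] outside [A] and with partners [C] for
    [A :\ a0].  Either [Y] covers [v], or [v] is a neighbour of [a0]; so [a0] is
    adjacent to every vertex that is left. *)
Lemma separating_face_unbalanced k u : (#|A| < k)%N -> A != set0 ->
  matchable e k [set: T] -> e v u ->
  exists2 F : {set T}, #|F| = (2 * k.-1)%N & separating_face k F.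
Proof.
move=> lt_k A0 mk evu; set s := #|A|.
have s0 : (0 < s)%N by rewrite card_gt0.
have mA : matchable e (k - s) (~: A) by have := matchable_setD A mk; rewrite setTD.
(* Every edge of a [k]-matching that meets [A] uses up one of its [s] vertices, so
   [k - s] edges lie outside [A]. *)
have [a0 [Y [a0A sY Yc mY va]]] : exists a0 Y, [/\ a0 \in A, Y \subset ~: A,
    #|Y| = (2 * (k - s))%N, matchable e (k - s) Y & (v \in Y) || e v a0].
  have [Y [sY Yc mY]] := matchable_exact e_irr mA.
  have [uA|uA] := boolP (u \in A); first by exists u, Y; rewrite evu orbT.
  have /set0Pn[a0 a0A] := A0.
  have [vY|vY] := boolP (v \in Y); first by exists a0, Y; rewrite vY.
  (* Trade the edge at [u], or any edge if there is none, for the edge [v u]. *)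
  have [Y0 [sY0 Y0c mY0]] := matchable_exact e_irr (matchable_remove u mY).
  have uY0 : u \notin Y0 by apply/negP => /(subsetP sY0); rewrite !inE eqxx.
  have sY0Y : Y0 \subset Y by apply: subset_trans sY0 (subsetDl _ _).
  have vY0 : v \notin Y0 by apply: contra vY; exact: subsetP.
  have vu : v \notin u |: Y0 by rewrite !inE negb_or vY0 (edge_neq e_irr evu).
  exists a0, (v |: (u |: Y0)); split=> //; last by rewrite setU11.
  - rewrite !subUset !sub1set !inE vA uA /=; exact: subset_trans sY0Y sY.
  - rewrite !cardsU1 vu uY0 Y0c; move: lt_k; rewrite -/s; clear; lia.
  - have -> : (k - s = (k - s).-1.+1)%N by move: lt_k; rewrite -/s; clear; lia.
    apply/matchableS; exists v, u; rewrite !inE !eqxx orbT; split=> //.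
    by rewrite setU1K // setU1K.
have nT : (2 * k <= #|T|)%N by have := matchable_card e_irr mk; rewrite cardsT.
have cB : (s + #|B| + 1 = #|T|)%N.
  have := cardsC [set v]; rewrite cards1 -AB_v cardsU (disjoint_setI0 dAB) cards0.
  by rewrite subn0 addnC.
have [C sC Cc] : exists2 C : {set T}, C \subset B :\: Y & #|C| = s.-1.
  apply: subset_of_card; have := cardsID Y B.
  have := subset_leq_card (subsetIr B Y); rewrite Yc.
  move: lt_k s0 nT cB; rewrite -/s; clear; lia.
have CB x : x \in C -> x \in B by move/(subsetP sC); rewrite inE => /andP[].
have CY x : x \in C -> x \notin Y by move/(subsetP sC); rewrite inE => /andP[].
have YA x : x \in Y -> x \notin A by move/(subsetP sY); rewrite inE.
have CA x : x \in C -> x \notin A by move/CB => xB; rewrite (disjointFl dAB).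
have dAC : [disjoint A :\ a0 & C].
  rewrite disjoint_sym disjoints_subset; apply/subsetP=> x /CA xA.
  by rewrite !inE (negbTE xA) andbF.
have Ac : #|A :\ a0| = s.-1 by rewrite /s (cardsD1 a0 A) a0A.
have dACY : [disjoint (A :\ a0) :|: C & Y].
  rewrite disjoints_subset; apply/subsetP=> x; rewrite !inE.
  by case/orP=> [/andP[_]|]; [apply: contraL; exact: YA | exact: CY].
pose F := (A :\ a0) :|: C :|: Y.
have Fc : #|F| = (2 * k.-1)%N.
  rewrite /F cardsU (disjoint_setI0 dACY) cards0 subn0.
  rewrite cardsU (disjoint_setI0 dAC) cards0 subn0 Ac Cc Yc.
  move: lt_k s0; rewrite -/s; clear; lia.
have a0F : a0 \notin F.
  rewrite !inE eqxx /= negb_or; apply/andP; split.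
    by apply: contraL a0A; exact: CA.
  by apply: contraL a0A; exact: YA.
exists F => //; exists [set a0]; split.
- by rewrite disjoints_subset sub1set inE.
- by exists a0; rewrite inE.
- have : (0 < #|~: (F :|: [set a0])|)%N.
    have := cardsC (F :|: [set a0]); rewrite setUC cardsU1 a0F Fc.
    move: lt_k s0 nT; rewrite -/s; clear; lia.
  by case/card_gt0P=> b; rewrite in_setC; exists b.
move=> a b /set1P ->; rewrite in_setU in_set1 negb_or => /andP[bF ba0].
move: (bF); rewrite !inE ba0 !negb_or /= => /andP[/andP[bA bC] bY].
have ea0b : e a0 b.
  have [bv|bv] := eqVneq b v.
    by move: va; rewrite bv in bY *; rewrite (negbTE bY) e_sym.
  by apply: AB_edges => //; have := ABv bv; rewrite (negbTE bA).
have m1 := matchable_edge (edge_neq e_irr ea0b) ea0b.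
have m2 : matchable e s.-1 ((A :\ a0) :|: C).
  apply: matchable_bipartite => // x y /setD1P[_ xA] /CB; exact: AB_edges.
have m3 := matchable_union dACY m2 mY.
have -> : k = (1 + (s.-1 + (k - s)))%N by move: lt_k s0; rewrite -/s; clear; lia.
apply: matchable_mono (matchable_union _ m1 m3).
  by apply/subsetP=> x; rewrite -/F !in_setU !in_set1 => /orP[/orP[]|] ->; rewrite ?orbT.
rewrite disjoints_subset -/F; apply/subsetP=> x; rewrite in_setC in_set2.
by case/orP=> /eqP ->.
Qed.

End Split.

Lemma separating_face_exists k v A B : (1 < k)%N -> matchable e k [set: T] ->
  A :|: B = [set~ v] -> [disjoint A & B] -> A != set0 -> B != set0 ->
  {in A & B, forall a b, e a b} -> (exists u, e v u) ->
  exists2 F : {set T}, #|F| = (2 * k.-1)%N & separating_face k F.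
Proof.
move=> k1 mk ABv dAB A0 B0 eAB [u evu].
have BAv : B :|: A = [set~ v] by rewrite setUC.
have dBA : [disjoint B & A] by rewrite disjoint_sym.
have eBA : {in B & A, forall b a, e b a} by move=> b a bB aA; rewrite e_sym eAB.
have [kA|kA] := leqP k #|A|; last first.
  exact: (separating_face_unbalanced ABv dAB eAB kA A0 mk evu).
have [kB|kB] := leqP k #|B|; last first.
  exact: (separating_face_unbalanced BAv dBA eBA kB B0 mk evu).
have : u \in A :|: B by rewrite ABv !inE eq_sym (edge_neq e_irr evu).
rewrite inE => /orP[uA|uB].
- exact: (separating_face_balanced ABv dAB eAB k1 kA kB uA evu).
- exact: (separating_face_balanced BAv dBA eBA k1 kB kA uB evu).
Qed.

End CutVertexMatchings.

(** * The normalized depth function of a cochordal graph *)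

Section EdgeIdealDepth.
Variables (K : fieldType) (n : nat) (e : rel 'I_n).
Hypotheses (e_sym : ssrbool.symmetric e) (e_irr : irreflexive e).
Local Notation S := {mpoly K[n]}.
Local Notation h := (compl_graph e).
Local Notation depth k := (depth_quotient (SR (unmatchable e k) : S -> Prop)).
Implicit Types (A B U F W : {set 'I_n}).

Lemma compl_graph_sym : ssrbool.symmetric h.
Proof. by move=> x y; rewrite /compl_graph /= eq_sym e_sym. Qed.

Lemma compl_graph_irr : irreflexive h.
Proof. by move=> x; rewrite /compl_graph /= eqxx. Qed.

Lemma compl_graphN x y : x != y -> ~~ h x y -> e x y.
Proof. by rewrite /compl_graph /= => -> /negPn. Qed.

Lemma unmatchable_small k B : (#|B| < 2 * k)%N -> B \in unmatchable e k.
Proof.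
by rewrite inE ltnNge; apply: contra => /(matchable_card e_irr).
Qed.

(** Independent sets of a graph are the cliques of its complement. *)
Lemma unmatchable1 : unmatchable e 1 = clique_complex h setT.
Proof.
apply/setP=> A; rewrite !inE subsetT andTb; apply/idP/cliqueP => [m x y xA yA ne|cl].
  apply: contraNT m => nh; apply/matchableS; exists x, y; split=> //.
  exact: compl_graphN.
apply/negP => /matchableS[i [j [iA jA eij _]]].
by have := cl i j iA jA (edge_neq e_irr eij); rewrite /compl_graph /= eij andbF.
Qed.

Lemma norm_depthE k : matchable e k setT ->
  norm_depth (edge_ideal K e) k = (depth k)%:Z - ((2 * k)%:Z - 1).
Proof.
by move=> mk; rewrite /norm_depth indeg_squarefree_pow // squarefree_pow_edge_ideal.
Qed.

(** A set of fewer than [2 * k] vertices has no room for [k] disjoint edges. *)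
Lemma depth_ge_skeleton k : (0 < k)%N -> matchable e k setT ->
  ((2 * k).-1 <= depth k)%N.
Proof.
move=> k0 mk; have := matchable_card e_irr mk; rewrite cardsT card_ord => le_n.
apply: depth_SR_ge; first exact: down_closed_unmatchable.
  by apply: unmatchable_small; rewrite cards0; lia.
apply: (@weakly_regular_skeleton _ _ _ set0 setT).
- exact: down_closed_unmatchable.
- by rewrite cards0 cardsT card_ord; lia.
- by move=> A _; rewrite set0U subsetT.
- by move=> A; rewrite setU0.
- by move=> A _; rewrite cards0 addn0 => le; apply: unmatchable_small; lia.
- by rewrite -setI_eq0 set0I.
Qed.

(** The sides of a separation of the complement are completely joined by edges,
    so deleting [U] from the complex leaves it disconnected. *)
Lemma depth_le_separable U : separable h (~: U) -> (depth 1 <= #|U| + 1)%N.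
Proof.
case=> A [/properP[sA [b bU bA]] /set0Pn[a aA] sepA].
have AU x : x \in A -> x \notin U by move/(subsetP sA); rewrite inE.
have dUA : [disjoint A & U].
  by rewrite disjoints_subset.
have := @depth_SR_le K n (unmatchable e 1) U set0 A a b.
rewrite cards0 addn0 !setU0; apply=> //.
- exact: down_closed_unmatchable.
- by rewrite -setI_eq0 setI0.
- by move: bU; rewrite !inE negb_or bA => ->.
- move=> x y xA; rewrite setU0 in_setU negb_or inE negbK => /andP[yU yA].
  apply: matchable_edge => //; first by apply: contraNneq yA => <-.
  apply: compl_graphN; first by apply: contraNneq yA => <-.
  by apply: sepA; rewrite // !inE yA.
- by move=> B _ le1; apply: unmatchable_small.
Qed.

Hypothesis e_cochordal : cochordal e.

Lemma depth_ge_connected c : highly_connected h c setT -> (c.+1 <= depth 1)%N.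
Proof.
move=> conn; apply: depth_SR_ge; first exact: down_closed_unmatchable.
  by apply: unmatchable_small; rewrite cards0.
rewrite unmatchable1; apply: weakly_regular_clique_complex => //.
- exact: compl_graph_sym.
- exact: compl_graph_irr.
Qed.

Hypothesis e_edge : exists i j, e i j.

Lemma matchable1 : matchable e 1 setT.
Proof. by have [i [j eij]] := e_edge; apply/matchableS; exists i, j; rewrite !inE. Qed.

Lemma connected_graphP : connected_graph h <-> ~ separable h setT.
Proof. exact: connected_onP. Qed.

Lemma cut_vertexP i : cut_vertex h i <-> separable h [set~ i].
Proof.
rewrite /cut_vertex connected_onP; split; first exact: NNPP.
by move=> sep; apply.
Qed.

Lemma depth_two : connected_graph h -> (exists i, cut_vertex h i) -> depth 1 = 2%N.
Proof.
move=> /connected_graphP con [i /cut_vertexP sep]; apply/eqP; rewrite eqn_leq.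
have := depth_le_separable sep; rewrite cards1 => -> /=.
apply: depth_ge_connected; split.
  exact: (matchable_card e_irr matchable1).
by move=> U; rewrite ltnS leqn0 cards_eq0 => /eqP ->; rewrite setD0.
Qed.

(** With neither a disconnection nor a cut vertex the graph is 2-connected and
    the depth is at least 3.  The bound on the number of vertices holds because
    the only graph on two vertices with an edge has a disconnected
    complement. *)
Lemma depth_two_cut_vertex : depth 1 = 2%N ->
  connected_graph h /\ exists i, cut_vertex h i.
Proof.
move=> d2; have con : ~ separable h setT.
  by rewrite -setC0 => /depth_le_separable; rewrite d2 cards0.
split; first exact/connected_graphP.
apply: NNPP => ncut; suff : (2.+1 <= depth 1)%N by rewrite d2.
apply: depth_ge_connected; split; last first.
  move=> U; rewrite ltnS leq_eqVlt ltnS leqn0 cards_eq0 => /orP[/cards1P[i ->]|/eqP->].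
    by rewrite setTD => sep; apply: ncut; exists i; apply/cut_vertexP.
  by rewrite setD0.
rewrite ltnNge; apply/negP => le2; apply: con.
have [i [j eij]] := e_edge; have ne := edge_neq e_irr eij.
have ijT : [set i; j] = setT.
  by apply/eqP; rewrite eqEcard subsetT cards2 ne.
exists [set i]; split.
- by rewrite properE subsetT /= -ijT subUset !sub1set !inE eqxx /= eq_sym.
- by apply/set0Pn; exists i; rewrite inE.
- move=> x y /set1P ->; rewrite -ijT !inE => /andP[/negbTE-> /= /eqP ->].
  by rewrite /compl_graph /= eij andbF.
Qed.

(** The lower bound comes from the skeleton, the upper bound from a face with
    disconnected link. *)
Lemma depth_pow k i : no_isolated e -> (2 <= k)%N -> matchable e k setT ->
  cut_vertex h i -> depth k = (2 * k).-1.
Proof.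
move=> noiso k2 mk /cut_vertexP[A [/properP[sA [b bi bA]] A0 sepA]].
have k0 : (0 < k)%N by exact: leq_trans k2.
apply/eqP; rewrite eqn_leq depth_ge_skeleton // andbT.
have [F Fk [X [dXF [a aX] [b0 b0F] HX]]] : exists2 F : {set 'I_n},
    #|F| = (2 * k.-1)%N & separating_face e k F.
  apply: (separating_face_exists e_sym e_irr (v := i) (A := A)
           (B := [set~ i] :\: A)) => //.
  - by rewrite -{1}(setIidPr sA) setID.
  - by rewrite disjoint_sym disjoints_subset setDE subsetIr.
  - by apply/set0Pn; exists b; rewrite inE bA.
  - move=> x y xA yB; apply: compl_graphN; last exact: sepA.
    by move: yB; rewrite inE => /andP[yA _]; apply: contraNneq yA => <-.
have := @depth_SR_le K n (unmatchable e k) set0 F X a b0.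
rewrite set0U cards0 add0n Fk.
have -> : (2 * k.-1 + 1 = (2 * k).-1)%N by move: k0; clear; lia.
apply=> //.
- exact: down_closed_unmatchable.
- by rewrite -setI_eq0 set0I.
- by move=> x y xX yN; rewrite inE negbK HX.
- move=> B _ le; apply: unmatchable_small; move: le k0; clear; lia.
Qed.

End EdgeIdealDepth.

Theorem theorem3p1 (K : fieldType) (n : nat) (e : rel 'I_n)
    (e_sym : ssrbool.symmetric e) (e_irr : irreflexive e)
    (e_edge : exists i j, e i j)
    (e_cochordal : cochordal e) (e_no_isolated : no_isolated e) :
  [<-> connected_graph (compl_graph e) /\
         (exists i, cut_vertex (compl_graph e) i);
       norm_depth (edge_ideal K e) 1 = 1;
       norm_depth (edge_ideal K e) 1 = 1 /\
         (forall k : nat, (2 <= k <= matching_number e)%N ->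
            norm_depth (edge_ideal K e) k = 0)].
Proof.
have m1 := matchable1 e_edge.
have depthE : norm_depth (edge_ideal K e) 1 = 1 <->
    depth_quotient (SR (unmatchable e 1) : {mpoly K[n]} -> Prop) = 2%N.
  by rewrite norm_depthE //; lia.
have i_of_ii : norm_depth (edge_ideal K e) 1 = 1 ->
    connected_graph (compl_graph e) /\ (exists i, cut_vertex (compl_graph e) i).
  by move/depthE; exact: depth_two_cut_vertex.
tfae.
- by move=> [con cut]; apply/depthE; exact: depth_two.
- move=> g1; split=> // k /andP[k2 /matchable_setT mk].
  have [_ [i cut]] := i_of_ii g1.
  by rewrite norm_depthE // (depth_pow _ _ _ _ _ mk cut) //; move: k2; clear; lia.
- by move=> [g1 _]; exact: i_of_ii.
Qed.
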